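(* For the Server Cloud Scheduling problem restricted to fully parallel task graphs there is an FPTAS with respect to the cost objective (minimize cost subject to makespan at most a given deadline $d$) and an FPTAS with respect to the makespan objective (minimize makespan subject to cost at most a given budget $b$).
   Context: Server Cloud Scheduling: the input is a directed acyclic task graph $G=(\mathcal{J},E)$ with exactly one source $s$ and one sink $t$; each job $j\in\mathcal{J}$ has a server processing time $p_s(j)\in\mathbb{N}_0$ and a cloud processing time $p_c(j)\in\mathbb{N}_0$, where $p_s(s)=p_s(t)=0$ and $p_c(s)=p_c(t)=\infty$; each edge $(i,j)\in E$ has a communication delay $c(i,j)\in\mathbb{N}_0$. There is one server machine (processing at most one job at a time) and unboundedly many cloud machines. A schedule is a partition $\mathcal{J}=\mathcal{J}_s\cup\mathcal{J}_c$ together with completion times $C:\mathcal{J}\to\mathbb{N}_0$; let $p_\pi(j)=p_s(j)$ if $j\in\mathcal{J}_s$ and $p_\pi(j)=p_c(j)$ if $j\in\mathcal{J}_c$. It is valid if (a) for distinct $i,j\in\mathcal{J}_s$: $C(i)\le C(j)-p_\pi(j)$ or $C(i)-p_\pi(i)\ge C(j)$; (b) for every edge $(i,j)$ with $i,j$ on the same side: $C(i)\le C(j)-p_\pi(j)$, and for every edge with $i,j$ on different sides: $C(i)+c(i,j)\le C(j)-p_\pi(j)$. The makespan is $C(t)$ and the cost is $\sum_{j\in\mathcal{J}_c}p_c(j)$. A task graph is fully parallel if every job $j\notin\{s,t\}$ has exactly two incident edges, namely $(s,j)$ and $(j,t)$. *)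

(* Defs.v *)
From mathcomp Require Import all_boot.
Unset Printing Implicit Defensive.

(* A task graph with jobs of a finite type, source [src], sink [snk],
   edge relation [edge], server times [ps], cloud times [pc] (None = infinity)
   and communication delays [cd] (only relevant on edges). *)
Record instance := Instance {
  job  : finType;
  src  : job;
  snk  : job;
  edge : rel job;
  ps   : job -> nat;
  pc   : job -> option nat;
  cd   : job -> job -> nat }.

(* A schedule: partition (on_cloud j = true iff j in J_c) and completion times. *)
Record schedule (J : Type) := Schedule {
  on_cloud : J -> bool;
  ctime    : J -> nat }.

(* processing time p_pi(j) (a cloud job with infinite cloud time gets 0 here,
   but such schedules are excluded by [valid]). *)
Definition ptime (I : instance) (S : schedule (job I)) (j : job I) : nat :=
  if on_cloud _ S j then odflt 0 (pc I j) else ps I j.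

(* Constraints C(i) <= C(j) - p(j) over the integers are written
   C(i) + p(j) <= C(j) over nat. *)
Definition valid (I : instance) (S : schedule (job I)) : Prop :=
  (forall j, on_cloud _ S j -> pc I j <> None) /\
  (forall i j : job I, i != j -> ~~ on_cloud _ S i -> ~~ on_cloud _ S j ->
      ctime _ S i + ps I j <= ctime _ S j \/ ctime _ S j + ps I i <= ctime _ S i) /\
  (forall i j : job I, edge I i j ->
      ctime _ S i + (if on_cloud _ S i == on_cloud _ S j then 0 else cd I i j)
        + ptime I S j <= ctime _ S j).

Definition makespan (I : instance) (S : schedule (job I)) : nat := ctime _ S (snk I).

Definition cost (I : instance) (S : schedule (job I)) : nat :=
  \sum_(j : job I | on_cloud _ S j) odflt 0 (pc I j).

(* Jobs: None = s, Some None = t, Some (Some i) = inner job i.              *)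
Definition fpjob (n : nat) : finType := option (option 'I_n).

Definition fp_edge n : rel (fpjob n) := fun i j =>
  match i, j with
  | None, Some (Some _) => true
  | Some (Some _), Some None => true
  | _, _ => false
  end.

Definition fp_instance n (psf pcf cin cout : 'I_n -> nat) : instance :=
  Instance (fpjob n) None (Some None) (fp_edge n)
    (fun j => if j is Some (Some k) then psf k else 0)
    (fun j => if j is Some (Some k) then Some (pcf k) else None)
    (fun i j => match i, j with
                | None, Some (Some k) => cin k
                | Some (Some k), Some None => cout k
                | _, _ => 0
                end).

(* Computational model: a unit-cost RAM with addition and truncated        *)
(* subtraction (polynomially equivalent to Turing machines), infinitely    *)
(* many natural-number registers, indirect addressing.                     *)
Inductive instr :=
| IConst (r v : nat)
| IAdd   (r a b : nat)
| ISub   (r a b : nat)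
| ILoad  (r a : nat)
| IStore (a r : nat)
| IJz    (r l : nat)
| IJmp   (l : nat)
| IHalt.

Record state := St { pcr : nat; mem : nat -> nat }.

Definition upd (m : nat -> nat) (r v : nat) : nat -> nat :=
  fun x => if x == r then v else m x.

Definition step (P : seq instr) (s : state) : state :=
  let m := mem s in let pc := pcr s in
  match nth IHalt P pc with
  | IConst r v => St (pc.+1) (upd m r v)
  | IAdd r a b => St (pc.+1) (upd m r (m a + m b))
  | ISub r a b => St (pc.+1) (upd m r (m a - m b))
  | ILoad r a => St (pc.+1) (upd m r (m (m a)))
  | IStore a r => St (pc.+1) (upd m (m a) (m r))
  | IJz r l => if m r == 0 then St l m else St (pc.+1) m
  | IJmp l => St l m
  | IHalt => s
  end.

Definition halted (P : seq instr) (s : state) : bool :=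
  if nth IHalt P (pcr s) is IHalt then true else false.

Definition run (P : seq instr) (T : nat) (s : state) : state := iter T (step P) s.

Definition init (inp : seq nat) : state :=
  St 0 (fun x => if x is y.+1 then nth 0 inp y else size inp).

Definition output (s : state) : seq nat := mkseq (fun i => mem s i.+1) (mem s 0).

Definition bitsize (inp : seq nat) : nat := \sum_(x <- inp) (trunc_log 2 x).+1.

Definition enc_fp n (psf pcf cin cout : 'I_n -> nat) : seq nat :=
  n :: flatten [seq [:: psf i; pcf i; cin i; cout i] | i <- enum 'I_n].

(* output format: [flag; C(s); C(t); b_0; C(0); ...; b_{n-1}; C(n-1)],
   flag = 0 means "no schedule", b_i <> 0 means job i is on the cloud. *)
Definition decode n (out : seq nat) : option (schedule (fpjob n)) :=
  if nth 0 out 0 == 0 then None else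
  Some (Schedule (fpjob n)
    (fun j => if j is Some (Some i) then nth 0 out (3 + 2 * i) != 0 else false)
    (fun j => match j with
              | None => nth 0 out 1
              | Some None => nth 0 out 2
              | Some (Some i) => nth 0 out (4 + 2 * i)
              end)).

(* FPTAS for the cost objective: input (d, eps = p/q, instance);
   runs in time polynomial in the input length and 1/eps;
   whenever some valid schedule has makespan <= d, it outputs a valid
   schedule with makespan <= d and cost <= (1+eps) * OPT. *)
Definition FPTAS_cost : Prop :=
  exists (P : seq instr) (a k : nat),
  forall n (psf pcf cin cout : 'I_n -> nat) (d p q : nat), 0 < p -> 0 < q ->
  let I := fp_instance n psf pcf cin cout in
  let inp := [:: d; p; q] ++ enc_fp n psf pcf cin cout in
  let fin := run P (a * (bitsize inp + q %/ p + 1) ^ k) (init inp) in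
  halted P fin /\
  ((exists S, valid I S /\ makespan I S <= d) ->
   exists S, decode n (output fin) = Some S /\
     valid I S /\ makespan I S <= d /\
     forall S', valid I S' -> makespan I S' <= d ->
       cost I S * q <= (q + p) * cost I S').

Definition FPTAS_makespan : Prop :=
  exists (P : seq instr) (a k : nat),
  forall n (psf pcf cin cout : 'I_n -> nat) (b p q : nat), 0 < p -> 0 < q ->
  let I := fp_instance n psf pcf cin cout in
  let inp := [:: b; p; q] ++ enc_fp n psf pcf cin cout in
  let fin := run P (a * (bitsize inp + q %/ p + 1) ^ k) (init inp) in
  halted P fin /\
  ((exists S, valid I S /\ cost I S <= b) ->
   exists S, decode n (output fin) = Some S /\
     valid I S /\ cost I S <= b /\
     forall S', valid I S' -> cost I S' <= b ->
       makespan I S * q <= (q + p) * makespan I S').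

(* Main.v *)
Require Import Defs.
From mathcomp Require Import all_boot zify.

(* Both objectives are instances of one problem: each job goes to one of two
   sides, the first side has a total load [w] to be minimised, the second side a
   total load [u] bounded by [B], and a job on the second side also costs a delay
   [f], the objective being the maximum of the load and of the delays.  For the
   cost objective the first side is the cloud ([w] = cloud time, [u] = server
   time, [f] = 0, jobs whose delay exceeds the deadline being barred from it);
   for the makespan objective it is the server ([w] = server time, [u] = cloud
   time, [f] = total delay of the job on the cloud).

   Guess the largest value G among the [w] of the first side and the [f] of the
   second side of an optimal solution, so that G is at most the optimum.  Scaling
   [w] by L^2 / G, with L at least the number of jobs and 1 / L at most epsilon,
   and rounding down loses at most G / L in total, and the rounded problem is
   solved by dynamic programming over the L^4 possible scaled loads.  A solution
   is stored as the bit mask of its second side.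

   The RAM has neither multiplication nor division: [q / p] is found by repeated
   subtraction (time polynomial in 1 / epsilon is available), the rounded loads by
   counting, and L = n + 2 + q / p is the only loop bound of the main program;
   the L - n missing jobs read zeros beyond the input. *)

Set Implicit Arguments.
Unset Strict Implicit.
Unset Printing Implicit Defensive.

(** * A structured language compiled to the RAM *)

Definition memory := nat -> nat.

Definition exec1 (m : memory) (i : instr) : memory :=
  match i with
  | IConst r v => upd m r v
  | IAdd r a b => upd m r (m a + m b)
  | ISub r a b => upd m r (m a - m b)
  | ILoad r a => upd m r (m (m a))
  | IStore a r => upd m (m a) (m r)
  | _ => m
  end.

Definition straight (i : instr) : bool :=
  match i with IJz _ _ | IJmp _ | IHalt => false | _ => true end.

Definition code_at (P : seq instr) (off : nat) (c : seq instr) : Prop :=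
  forall i, i < size c -> nth IHalt P (off + i) = nth IHalt c i.

Lemma code_at_cat P off c1 c2 : code_at P off (c1 ++ c2) ->
  code_at P off c1 /\ code_at P (off + size c1) c2.
Proof.
move=> H; split=> i Hi.
  by rewrite H ?size_cat ?nth_cat ?Hi // ltn_addr.
by rewrite -addnA H ?size_cat ?nth_cat ?ltn_add2l // ltnNge leq_addr /= addKn.
Qed.

Lemma code_at_cons P off i c : code_at P off (i :: c) ->
  nth IHalt P off = i /\ code_at P off.+1 c.
Proof.
move=> H; split; first by rewrite -[off]addn0 H.
by move=> j Hj; rewrite addSnnS H.
Qed.

Lemma runD P t1 t2 s : run P (t1 + t2) s = run P t2 (run P t1 s).
Proof. by rewrite /run addnC iterD. Qed.

Lemma step_straight P pc m i : nth IHalt P pc = i -> straight i ->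
  step P (St pc m) = St pc.+1 (exec1 m i).
Proof. by rewrite /step => /= ->; case: i. Qed.

Lemma run_straight P c off m : all straight c -> code_at P off c ->
  run P (size c) (St off m) = St (off + size c) (foldl exec1 m c).
Proof.
elim: c off m => [|i c IH] off m; first by rewrite addn0.
move=> /andP[Hi Hc] /code_at_cons [Hn Hat].
by rewrite [size _]/= [run _ _ _]iterSr (step_straight _ Hn Hi) -/(run _ _ _) IH // addSnnS.
Qed.

Lemma step_jz P pc m r l : nth IHalt P pc = IJz r l ->
  step P (St pc m) = if m r == 0 then St l m else St pc.+1 m.
Proof. by rewrite /step => /= ->. Qed.

Lemma step_jmp P pc m l : nth IHalt P pc = IJmp l -> step P (St pc m) = St l m.
Proof. by rewrite /step => /= ->. Qed.

Inductive expr :=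
| Cst (v : nat)
| Arr (k : nat) (e : expr)
| Plus (e1 e2 : expr)
| Minus (e1 e2 : expr).

Inductive cmd :=
| Skip
| Put (k : nat) (e1 e2 : expr)
| Seq (c1 c2 : cmd)
| If (e : expr) (c1 c2 : cmd)
| For (c : cmd).

(* An environment is a family of arrays; a scalar variable is cell 0 of its array. *)
Definition env := nat -> nat -> nat.

Fixpoint eval (s : env) (e : expr) : nat :=
  match e with
  | Cst v => v
  | Arr k e => s k (eval s e)
  | Plus e1 e2 => eval s e1 + eval s e2
  | Minus e1 e2 => eval s e1 - eval s e2
  end.

Definition put (s : env) (k i v : nat) : env :=
  fun k' i' => if eqn k' k && eqn i' i then v else s k' i'.

(* [If e] takes the first branch on 0.  Every loop runs [s 1 0] times, so a
   command that does not write array 1 has a running time polynomial in [s 1 0]. *)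
Fixpoint sem (c : cmd) (s : env) : env :=
  match c with
  | Skip => s
  | Put k e1 e2 => put s k (eval s e1) (eval s e2)
  | Seq c1 c2 => sem c2 (sem c1 s)
  | If e c1 c2 => if eval s e == 0 then sem c1 s else sem c2 s
  | For c => iter (s 1 0) (sem c) s
  end.

Fixpoint mods (c : cmd) : seq nat :=
  match c with
  | Skip => [::]
  | Put k _ _ => [:: k]
  | Seq c1 c2 | If _ c1 c2 => mods c1 ++ mods c2
  | For c => mods c
  end.

Lemma sem_frame c s k i : k \notin mods c -> sem c s k i = s k i.
Proof.
elim: c s => [|k' e1 e2|c1 IH1 c2 IH2|e c1 IH1 c2 IH2|c IH] s //=.
- by rewrite inE /put -[eqn k k']/(k == k') => /negPf ->.
- by rewrite mem_cat negb_or => /andP[H1 H2]; rewrite IH2 // IH1.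
- by rewrite mem_cat negb_or => /andP[H1 H2]; case: ifP => _; rewrite ?IH2 // IH1.
- by move=> H; elim: (s 1 0) => //= n IHn; rewrite IH.
Qed.

(* Register 0 holds the base of the arrays, array [k] occupies the addresses
   congruent to [k] modulo 32 above it; loop counters live in registers below
   32 (by nesting depth) and temporaries in registers 32 to 63. *)
Definition represents (base : nat) (s : env) (m : memory) : Prop :=
  m 0 = base /\ forall k i, k < 32 -> m (base + 32 * i + k) = s k i.

(** Five doublings multiply the index in register [t] by 32; adding [k] and the base from register 0
    then gives the address of the cell. *)
Definition addr_code (t k : nat) : seq instr :=
  [:: IAdd t t t; IAdd t t t; IAdd t t t; IAdd t t t; IAdd t t t;
      IConst t.+1 k; IAdd t t t.+1; IAdd t t 0].

Fixpoint cexpr (t : nat) (e : expr) : seq instr :=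
  match e with
  | Cst v => [:: IConst t v]
  | Arr k e => cexpr t e ++ addr_code t k ++ [:: ILoad t t]
  | Plus e1 e2 => cexpr t e1 ++ cexpr t.+1 e2 ++ [:: IAdd t t t.+1]
  | Minus e1 e2 => cexpr t e1 ++ cexpr t.+1 e2 ++ [:: ISub t t t.+1]
  end.

Fixpoint esize (e : expr) : nat :=
  match e with
  | Cst _ => 1
  | Arr _ e => esize e + 9
  | Plus e1 e2 | Minus e1 e2 => esize e1 + (esize e2 + 1)
  end.

Fixpoint ewf (t : nat) (e : expr) : bool :=
  match e with
  | Cst _ => t < 64
  | Arr k e => [&& k < 32, t.+1 < 64 & ewf t e]
  | Plus e1 e2 | Minus e1 e2 => ewf t e1 && ewf t.+1 e2
  end.

Lemma ewf_lt t e : ewf t e -> t < 64.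
Proof.
elim: e => [v|k e IH|e1 IH1 e2 _|e1 IH1 e2 _] //= => [/and3P[_ _ /IH]|/andP[/IH1]|/andP[/IH1]] //.
Qed.

Lemma size_cexpr t e : size (cexpr t e) = esize e.
Proof.
by elim: e t => [v|k e IH|e1 IH1 e2 IH2|e1 IH1 e2 IH2] t //=;
  rewrite !size_cat /= ?IH ?IH1 ?IH2.
Qed.

Lemma straight_cexpr t e : all straight (cexpr t e).
Proof.
by elim: e t => [v|k e IH|e1 IH1 e2 IH2|e1 IH1 e2 IH2] t //=;
  rewrite !all_cat /= ?IH ?IH1 ?IH2.
Qed.

Lemma updE m r v x : upd m r v x = if x == r then v else m x.
Proof. by []. Qed.

Lemma upd_same m r v : upd m r v r = v.
Proof. by rewrite updE eqxx. Qed.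

Lemma upd_neq m r v x : x != r -> upd m r v x = m x.
Proof. by rewrite updE => /negPf ->. Qed.

Lemma addr_code_ok m t k : 0 < t ->
  let m' := foldl exec1 m (addr_code t k) in
  m' t = m 0 + 32 * m t + k /\ forall x, (x < t) || (t.+1 < x) -> m' x = m x.
Proof.
move=> t0; rewrite /addr_code /=; split=> [|x Hx].
  have e1 : (t == t.+1) = false by lia.
  have e2 : (0 == t) = false by lia.
  have e3 : (t.+1 == t) = false by lia.
  by rewrite !updE !eqxx ?(e1, e2, e3, eqxx) /=; lia.
have e1 : (x == t.+1) = false by lia.
have e2 : (x == t) = false by lia.
by rewrite !updE !(e1, e2).
Qed.

Lemma represents_frame base s m m' : 64 <= base -> represents base s m ->
  m' 0 = m 0 -> (forall x, 64 <= x -> m' x = m x) -> represents base s m'.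
Proof.
move=> Hb [H0 Ha] E0 E; split; first by rewrite E0.
by move=> k i Hk; rewrite E ?Ha //; lia.
Qed.

(** The induction rests on the frame clause: registers below [t] survive, so a left operand kept in
    [t] is intact after the right one is evaluated in [t.+1]; addresses from 64 on survive, so the
    arrays are intact. *)
Lemma cexpr_ok base s e t m : 64 <= base -> represents base s m -> 0 < t ->
  ewf t e ->
  let m' := foldl exec1 m (cexpr t e) in
  m' t = eval s e /\ forall x, (x < t) || (64 <= x) -> m' x = m x.
Proof.
move=> Hb; elim: e t m => [v|k e IH|e1 IH1 e2 IH2|e1 IH1 e2 IH2] t m Hr t0.
- by move=> /= Ht; split=> [|x Hx]; rewrite ?upd_same // upd_neq //; lia.
- rewrite [ewf _ _]/= => /and3P[Hk Ht He].
  rewrite -[cexpr _ _]/(cexpr t e ++ addr_code t k ++ [:: ILoad t t]) !foldl_cat.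
  have [E1 F1] := IH t m Hr t0 He; move: (foldl exec1 m _) E1 F1 => m1 E1 F1.
  have Hr1 : represents base s m1.
    by apply: (represents_frame Hb Hr) => [|x Hx]; apply: F1; lia.
  have [E2 F2] := addr_code_ok m1 k t0; move: (foldl exec1 m1 _) E2 F2 => m2 E2 F2.
  split; last by move=> x Hx; rewrite /= upd_neq ?F2 ?F1 //; lia.
  rewrite /= upd_same E2 E1 Hr1.1 F2; first by rewrite Hr1.2.
  by apply/orP; right; lia.
all: rewrite [ewf _ _]/= [cexpr _ _]/= !foldl_cat => /andP[He1 He2].
all: have [E1 F1] := IH1 t m Hr t0 He1; move: (foldl exec1 m _) E1 F1 => m1 E1 F1.
all: have Hr1 : represents base s m1
  by apply: (represents_frame Hb Hr) => [|x Hx]; apply: F1; lia.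
all: have [E2 F2] := IH2 t.+1 m1 Hr1 isT He2; move: (foldl exec1 m1 _) E2 F2 => m2 E2 F2.
all: split=> [|x Hx]; rewrite /=; first by rewrite upd_same E2 F2 ?E1 ?leqnn.
all: have := ewf_lt He1 => Ht.
all: by rewrite upd_neq ?F2 ?F1 //; lia.
Qed.

(** [IJz] jumps to the branch taken on 0, so the other branch is laid out first. A loop reads its
    bound once, in ten instructions, into register [d]; the test sits at [off + 10] and the body at
    [off + 11]. *)
Fixpoint ccmd (d off : nat) (c : cmd) : seq instr :=
  match c with
  | Skip => [::]
  | Put k e1 e2 =>
      cexpr 32 e1 ++ addr_code 32 k ++ cexpr 33 e2 ++ [:: IStore 32 33]
  | Seq c1 c2 =>
      let p1 := ccmd d off c1 in p1 ++ ccmd d (off + size p1) c2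
  | If e c1 c2 =>
      let p2 := ccmd d (off + esize e).+1 c2 in
      let l1 := (off + esize e).+1 + (size p2).+1 in
      let p1 := ccmd d l1 c1 in
      cexpr 32 e ++ [:: IJz 32 l1] ++ p2 ++ [:: IJmp (l1 + size p1)] ++ p1
  | For c =>
      let p := ccmd d.+1 (off + 11) c in
      cexpr d (Arr 1 (Cst 0)) ++ [:: IJz d (off + 11 + size p + 3)] ++ p ++
      [:: IConst 32 1; ISub d d 32; IJmp (off + 10)]
  end.

Fixpoint cwf (d : nat) (c : cmd) : bool :=
  match c with
  | Skip => true
  | Put k e1 e2 => [&& k < 32, ewf 32 e1 & ewf 33 e2]
  | Seq c1 c2 => cwf d c1 && cwf d c2
  | If e c1 c2 => [&& ewf 32 e, cwf d c1 & cwf d c2]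
  | For c => (d < 31) && cwf d.+1 c
  end.

(** [Z] is the common number of iterations of all loops. For a loop, 11 pays for reading the bound
    and for the last test, 4 for the test, decrement and jump of each iteration. *)
Fixpoint tb (c : cmd) (Z : nat) : nat :=
  match c with
  | Skip => 0
  | Put k e1 e2 => esize e1 + esize e2 + 9
  | Seq c1 c2 => tb c1 Z + tb c2 Z
  | If e c1 c2 => esize e + 2 + tb c1 Z + tb c2 Z
  | For c => 11 + Z * (tb c Z + 4)
  end.

(** The last clause protects the counters of the enclosing loops, which live in registers below [d].
    Since array 1 is never written, all subcommands see the same loop bound. *)
Lemma ccmd_ok P base c d off s m : 64 <= base -> 0 < d < 32 ->
  represents base s m -> cwf d c -> 1 \notin mods c ->
  code_at P off (ccmd d off c) ->
  exists t m', [/\ t <= tb c (s 1 0),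
    run P t (St off m) = St (off + size (ccmd d off c)) m',
    represents base (sem c s) m' & forall x, 0 < x < d -> m' x = m x].
Proof.
move=> Hb; elim: c d off s m =>
    [|k e1 e2|c1 IH1 c2 IH2|e c1 IH1 c2 IH2|c IH] d off s m d0 Hr.
- by move=> _ _ _; exists 0, m; rewrite addn0.
- rewrite [cwf _ _]/= => /and3P[Hk He1 He2] _ Hat.
  set cc := ccmd _ _ _ in Hat *.
  have Ecc : cc = cexpr 32 e1 ++ addr_code 32 k ++ cexpr 33 e2 ++ [:: IStore 32 33].
    by [].
  exists (size cc), (foldl exec1 m cc).
  have Hs : all straight cc by rewrite Ecc !all_cat !straight_cexpr.
  rewrite run_straight //.
  have [E1 F1] := cexpr_ok (t := 32) Hb Hr isT He1.
  rewrite [in foldl _ _ _]Ecc !foldl_cat; move: (foldl exec1 m _) E1 F1 => m1 E1 F1.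
  have Hr1 : represents base s m1.
    by apply: (represents_frame Hb Hr) => [|x Hx]; apply: F1; lia.
  have [E2 F2] := addr_code_ok m1 k (isT : 0 < 32).
  move: (foldl exec1 m1 _) E2 F2 => m2 E2 F2.
  have Hr2 : represents base s m2.
    by apply: (represents_frame Hb Hr1) => [|x Hx]; apply: F2; lia.
  have [E3 F3] := cexpr_ok (t := 33) Hb Hr2 isT He2.
  move: (foldl exec1 m2 _) E3 F3 => m3 E3 F3.
  have Hr3 : represents base s m3.
    by apply: (represents_frame Hb Hr2) => [|x Hx]; apply: F3; lia.
  have Ea : m3 32 = base + 32 * eval s e1 + k.
    by rewrite F3 // E2 E1 Hr1.1.
  split=> //.
  + by rewrite !size_cat !size_cexpr /=; lia.
  + rewrite /= Ea E3; split; first by rewrite upd_neq ?Hr3.1 //; lia.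
    move=> k' i' Hk'; rewrite updE /put.
    rewrite -[eqn k' k]/(k' == k) -[eqn i' _]/(i' == _).
    (* Both [k] and [k'] are below 32, so an address determines the array and the index. *)
    have -> : (base + 32 * i' + k' == base + 32 * eval s e1 + k) =
        (k' == k) && (i' == eval s e1).
      by lia.
    by case: ifP => // _; rewrite Hr3.2.
  + by move=> x Hx; rewrite /= Ea upd_neq ?F3 ?F2 ?F1 //; lia.
- move=> /= /andP[Hw1 Hw2]; rewrite mem_cat negb_or => /andP[Hm1 Hm2].
  move=> /code_at_cat [Hat1 Hat2].
  have [t1 [m1 [Ht1 Hrun1 Hr1 F1]]] := IH1 d off s m d0 Hr Hw1 Hm1 Hat1.
  have [t2 [m2 [Ht2 Hrun2 Hr2 F2]]] := IH2 d _ _ m1 d0 Hr1 Hw2 Hm2 Hat2.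
  exists (t1 + t2), m2; split=> //.
  + by rewrite leq_add // (leq_trans Ht2) // sem_frame.
  + by rewrite runD Hrun1 Hrun2 size_cat addnA.
  + by move=> x Hx; rewrite F2 ?F1.
- move=> /= /and3P[He Hw1 Hw2]; rewrite mem_cat negb_or => /andP[Hm1 Hm2].
  set l2 := (off + esize e).+1; set p2 := ccmd d l2 c2.
  set l1 := l2 + (size p2).+1; set p1 := ccmd d l1 c1.
  move=> /code_at_cat [Hat0]; rewrite size_cexpr => /code_at_cons [Hjz].
  move=> /code_at_cat [Hat2]; rewrite -/l2 => /code_at_cons [Hjmp].
  rewrite -addnS -/l1 => Hat1.
  have := run_straight m (straight_cexpr _ _) Hat0; rewrite size_cexpr.
  have [E1 F1] := cexpr_ok (t := 32) Hb Hr isT He; move: (foldl exec1 m _) E1 F1 => m1 E1 F1.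
  move=> Hrun0.
  have Hr1 : represents base s m1.
    by apply: (represents_frame Hb Hr) => [|x Hx]; apply: F1; lia.
  have Hrun1 : run P (esize e + 1) (St off m) =
      if eval s e == 0 then St l1 m1 else St l2 m1.
    by rewrite runD Hrun0 /run /= (step_jz _ Hjz) E1.
  have -> : off + size (cexpr 32 e ++ IJz 32 l1 :: p2 ++ IJmp (l1 + size p1) :: p1)
      = l1 + size p1.
    by rewrite !(size_cat, size_cexpr) /= size_cat /= /l1 /l2; lia.
  case: ifP Hrun1 => _ Hrun1.
  + have [t [m2 [Ht Hrun2 Hr2 F2]]] := IH1 d l1 s m1 d0 Hr1 Hw1 Hm1 Hat1.
    exists (esize e + 1 + t), m2; split=> //; first by lia.
      by rewrite runD Hrun1 Hrun2.
    by move=> x Hx; rewrite F2 // F1 //; lia.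
  + have [t [m2 [Ht Hrun2 Hr2 F2]]] := IH2 d l2 s m1 d0 Hr1 Hw2 Hm2 Hat2.
    exists (esize e + 1 + (t + 1)), m2; split=> //; first by lia.
      by rewrite runD Hrun1 runD Hrun2 /run /= (step_jmp _ Hjmp).
    by move=> x Hx; rewrite F2 // F1 //; lia.
- rewrite [cwf _ _]/= [mods _]/= => /andP[Hd Hw] Hm.
  pose p := ccmd d.+1 (off + 11) c; pose fin := off + 11 + size p + 3.
  pose post := [:: IConst 32 1; ISub d d 32; IJmp (off + 10)].
  rewrite -[ccmd _ _ _]/(cexpr d (Arr 1 (Cst 0)) ++ IJz d fin :: p ++ post).
  move=> /code_at_cat [Hat0]; rewrite size_cexpr => /code_at_cons [Hjz].
  move=> /code_at_cat [Hat1 Hat2].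
  have := run_straight m (straight_cexpr _ _) Hat0; rewrite size_cexpr.
  have Hwd : ewf d (Arr 1 (Cst 0)) by rewrite /=; lia.
  have [d1 d2] := andP d0.
  have [E1 F1] := cexpr_ok Hb Hr d1 Hwd; move: (foldl exec1 m _) E1 F1 => m1 E1 F1.
  have Hr1 : represents base s m1.
    by apply: (represents_frame Hb Hr) => [|x Hx]; apply: F1; lia.
  move=> Hrun0.
  (* Induction on the number of iterations left, held in register [d], starting at the test; the
     environment is arbitrary except for the loop bound. *)
  have Hloop : forall k s1 m2, s1 1 0 = s 1 0 -> represents base s1 m2 -> m2 d = k ->
    (forall x, 0 < x < d -> m2 x = m x) ->
    exists t m', [/\ t <= 1 + k * (tb c (s 1 0) + 4),
      run P t (St (off + 10) m2) = St fin m',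
      represents base (iter k (sem c) s1) m' & forall x, 0 < x < d -> m' x = m x].
    elim=> [|k IHk] s1 m2 Es Hr2 Hk F2.
      exists 1, m2; split=> //.
      by rewrite /run /= (step_jz _ Hjz) Hk.
    have Hstep : run P 1 (St (off + 10) m2) = St (off + 11) m2.
      by rewrite /run /= (step_jz _ Hjz) Hk addnS.
    have d0' : 0 < d.+1 < 32 by lia.
    rewrite /= -addnS in Hat1.
    have [t1 [m3 [Ht1 Hrun1 Hr3 F3]]] := IH _ (off + 11) s1 m2 d0' Hr2 Hw Hm Hat1.
    rewrite /= -addnS in Hat2.
    have [Hc /code_at_cons [Hs /code_at_cons [Hj _]]] := code_at_cons Hat2.
    pose m4 := upd (upd m3 32 1) d (m3 d - 1).
    have Hrun2 : run P 3 (St (off + 11 + size p) m3) = St (off + 10) m4.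
      rewrite /run [iter _ _ _]/= (step_straight _ Hc) //.
      rewrite (step_straight _ Hs) // (step_jmp _ Hj).
      rewrite /m4 /exec1; congr (St _ (upd _ _ _)).
      by rewrite !updE eqxx (_ : (d == 32) = false) //; lia.
    have Fm x : 64 <= x \/ 0 < x < d \/ x = 0 -> m4 x = m3 x.
      by move=> Hx; rewrite /m4 !upd_neq //; lia.
    have [||||t2 [m5 [Ht2 Hrun3 Hr5 F5]]] := IHk (sem c s1) m4.
    + by rewrite sem_frame.
    + by apply: (represents_frame Hb Hr3) => [|x Hx]; apply: Fm; lia.
    + by rewrite /m4 upd_same F3 ?Hk ?ltnS ?d1 ?leqnn // subn1.
    + by move=> x Hx; rewrite Fm ?F3 ?F2 //; lia.
    exists (1 + (t1 + (3 + t2))), m5; split=> //.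
    + by rewrite Es in Ht1; rewrite mulSn; lia.
    + by rewrite runD Hstep runD Hrun1 runD Hrun2.
    + by rewrite iterSr.
  have [||t [m' [Ht Hrun Hr' F']]] := Hloop (s 1 0) s m1 erefl Hr1.
  + by rewrite E1.
  + by move=> x Hx; rewrite F1 //; lia.
  exists (10 + t), m'; split=> //.
  + rewrite runD Hrun0 Hrun; congr St.
    by rewrite size_cat size_cexpr /= size_cat /= /fin; lia.
Qed.

Lemma tb_poly c : exists a k, forall Z, tb c Z <= a * Z.+1 ^ k.
Proof.
have weak a k k' Z : k <= k' -> a * Z.+1 ^ k <= a * Z.+1 ^ k'.
  by move=> H; rewrite leq_mul2l leq_pexp2l ?orbT.
elim: c => [|k e1 e2|c1 [a1 [k1 IH1]] c2 [a2 [k2 IH2]]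
  |e c1 [a1 [k1 IH1]] c2 [a2 [k2 IH2]]|c [a [k IH]]] /=.
- by exists 0, 0.
- by exists (esize e1 + esize e2 + 9), 0 => Z; rewrite muln1.
- exists (a1 + a2), (k1 + k2) => Z; rewrite mulnDl leq_add //.
    by apply: (leq_trans (IH1 Z)); apply: weak; rewrite leq_addr.
  by apply: (leq_trans (IH2 Z)); apply: weak; rewrite leq_addl.
- exists (esize e + 2 + a1 + a2), (k1 + k2) => Z.
  have H0 : 0 < Z.+1 ^ (k1 + k2) by rewrite expn_gt0.
  have H1 := leq_trans (IH1 Z) (weak a1 _ _ Z (leq_addr k2 k1)).
  have H2 := leq_trans (IH2 Z) (weak a2 _ _ Z (leq_addl k1 k2)).
  by rewrite !mulnDl; nia.
- exists (a + 15), k.+1 => Z; rewrite expnS mulnCA.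
  have H1 : 0 < Z.+1 ^ k by rewrite expn_gt0.
  by have := IH Z; rewrite mulnDl; nia.
Qed.

(** * The two-sided assignment problem *)

Definition sum_if (y : nat -> bool) (g : nat -> nat) (k : nat) : nat :=
  \sum_(i < k) (if y i then g i else 0).

Lemma sum_if0 y g : sum_if y g 0 = 0.
Proof. exact: big_ord0. Qed.

Lemma sum_ifS y g k : sum_if y g k.+1 = sum_if y g k + (if y k then g k else 0).
Proof. exact: big_ord_recr. Qed.

Lemma eq_sum_if y y' g k : (forall i, i < k -> y i = y' i) ->
  sum_if y g k = sum_if y' g k.
Proof. by move=> H; apply: eq_bigr => i _; rewrite H. Qed.

(** The lower bits never reach the next power of two, so a mask can be read back from its highest
    bit by comparisons alone. *)
Lemma sum_if_pow2_lt y k : sum_if y (expn 2) k < 2 ^ k.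
Proof.
by elim: k => [|k IH]; rewrite ?sum_if0 // sum_ifS expnS; case: ifP => _; lia.
Qed.

Section TwoSided.

(* Item [i] goes to one of two sides, [y i] telling whether it is the second.
   The first side has load [w], the second [u] and delay [f]; [h i <> 0] forbids the first. *)
Variables (w u h f : nat -> nat) (B L : nat).

Definition feasible (y : nat -> bool) : Prop :=
  (forall i, i < L -> ~~ y i -> h i = 0) /\ sum_if y u L <= B.

Definition objective (y : nat -> bool) : nat :=
  maxn (sum_if (negb \o y) w L) (\max_(i < L) (if y i then f i else 0)).

Definition scale := L * L.

(** A term is 1 exactly when [k.+1 * G <= scale * w i], so the sum counts the positive multiples of
    [G] that fit, among the first [t]. *)
Definition scaled_upto (G i t : nat) : nat :=
  \sum_(k < t) (1 - (k.+1 * G - scale * w i)).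

(* [scale * w i %/ G] capped at [scale], computed without division; it is [scale] when [G = 0]. *)
Definition scaled (G i : nat) : nat := scaled_upto G i scale.

Lemma scaled_uptoS G i t :
  scaled_upto G i t.+1 = scaled_upto G i t + (1 - (t.+1 * G - scale * w i)).
Proof. exact: big_ord_recr. Qed.

(** The multiples that fit form an initial segment: the count either has kept pace with [t] or has
    stopped at the true quotient. *)
Lemma scaled_uptoP G i t :
  [/\ scaled_upto G i t <= t, G * scaled_upto G i t <= scale * w i &
      scaled_upto G i t = t \/ scale * w i < (scaled_upto G i t).+1 * G].
Proof.
elim: t => [|t [H1 H2 H3]]; first by rewrite /scaled_upto big_ord0 muln0; split; auto.
rewrite scaled_uptoS; move: (scaled_upto G i t) H1 H2 H3 => c H1 H2 H3.
case: (leqP (t.+1 * G) (scale * w i)) => H.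
  have -> : t.+1 * G - scale * w i = 0 by lia.
  case: H3 => [->|H3]; first by rewrite subn0 addn1 mulnC; split; auto.
  have H4 : c.+1 * G <= t.+1 * G by rewrite leq_mul2r ltnS H1 orbT.
  lia.
have -> : 1 - (t.+1 * G - scale * w i) = 0 by lia.
rewrite addn0; split=> //; first exact: leqW.
by case: H3 => [Ec|H3]; right; rewrite // Ec.
Qed.

Lemma scaled_le G i : scaled G i <= scale.
Proof. by case: (scaled_uptoP G i scale). Qed.

Lemma mul_scaled_le G i : G * scaled G i <= scale * w i.
Proof. by case: (scaled_uptoP G i scale). Qed.

(** For [w i <= G] the cap does no harm: a count that reached [scale] already gives
    [G * scale >= scale * w i]. *)
Lemma le_mul_scaled G i : w i <= G -> scale * w i <= G * scaled G i + G.
Proof.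
move=> Hw; rewrite /scaled; have [_ _] := scaled_uptoP G i scale.
move: (scaled_upto G i scale) => c [->|]; last by rewrite mulSn mulnC; lia.
by rewrite [G * scale]mulnC (leq_trans (leq_mul (leqnn scale) Hw)) // leq_addr.
Qed.

Definition cell : Type := nat * nat * nat.
Definition second_load (c : cell) := c.1.1.
Definition first_load (c : cell) := c.1.2.
Definition mask (c : cell) := c.2.

(** Charging [B.+1] for a forbidden choice pushes the load above [B] for good, which spares a
    separate mark for infeasibility. *)
Definition side_cost (a v : nat) : nat := if a == 0 then v else B.+1.

(* Cell [scale + v] is the least second-side load over the choices for the first
   [k] items whose scaled first-side load is [v]; loads above [B] mean that
   there is no such choice.  The cells below [scale] only avoid negative indices. *)
Fixpoint table (G k j : nat) : cell :=
  if k is k'.+1 then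
    if j < scale then table G k' j else
    let cx := table G k' (j - scaled G k') in
    let cy := table G k' j in
    let xs := second_load cx + side_cost (h k' + (w k' - G)) 0 in
    let ys := second_load cy + side_cost (f k' - G) (u k') in
    if xs - ys == 0 then (xs, first_load cx + w k', mask cx)
    else (ys, first_load cy, mask cy + 2 ^ k')
  else if j == scale then (0, 0, 0) else (B.+1, 0, 0).

Definition allowed (G k : nat) (y : nat -> bool) : Prop :=
  forall i, i < k -> if y i then is_true (f i <= G) else h i = 0 /\ w i <= G.

Lemma table_sound G k j : second_load (table G k j) <= B ->
  exists y, [/\ allowed G k y, j = scale + sum_if (negb \o y) (scaled G) k,
    second_load (table G k j) = sum_if y u k,
    first_load (table G k j) = sum_if (negb \o y) w k &
    mask (table G k j) = sum_if y (expn 2) k].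
Proof.
elim: k j => [|k IH] j /=.
  case: eqP => [->|_] H; last by rewrite /second_load /= ltnn in H.
  by exists xpredT; rewrite !sum_if0 addn0; split.
case: (ltnP j scale) => Hj.
  (* A realised cell has index at least [scale], so this case is contradictory. *)
  move=> /IH [y [_ Ej]]; move: Hj; rewrite Ej; lia.
have upd b y : allowed G k y -> (if b then is_true (f k <= G) else h k = 0 /\ w k <= G) ->
    let y' := fun i => if i == k then b else y i in
    [/\ allowed G k.+1 y', forall g, sum_if y' g k.+1 = sum_if y g k + (if b then g k else 0)
      & forall g, sum_if (negb \o y') g k.+1 =
          sum_if (negb \o y) g k + (if b then 0 else g k)].
  move=> Ha Hb y'.
  have E i : i < k -> y' i = y i by rewrite /y'; case: ltngtP.
  have Ek : y' k = b by rewrite /y' eqxx.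
  split=> [i|g|g].
  - rewrite ltnS leq_eqVlt => /predU1P[->|Hi]; first by rewrite Ek.
    by rewrite E //; apply: Ha.
  - by rewrite sum_ifS Ek (eq_sum_if _ E).
  - rewrite sum_ifS /= Ek (@eq_sum_if _ (negb \o y)) => [|i Hi]; last by rewrite /= E.
    by case: b {Hb y' E Ek}.
case: ifP => _; rewrite /second_load /first_load /mask /= => H.
  have [|y [Ha Ej E1 E2 E3]] := IH (j - scaled G k).
    by apply: leq_trans H; rewrite leq_addr.
  (* A total of at most [B] excludes the penalty [B.+1], so the choice was allowed. *)
  have Hc : h k + (w k - G) = 0.
    by move: H; rewrite /side_cost; case: eqP => // _; lia.
  have [|Ha' S1 S2] := upd false y Ha; first by lia.
  exists (fun i => if i == k then false else y i).
  rewrite !S1 !S2 /side_cost Hc eqxx !addn0 -E1 -E2 -E3.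
  (* Since [scaled G k <= scale <= j], the subtraction [j - scaled G k] is not truncated. *)
  by split=> //; have := scaled_le G k; lia.
have [|y [Ha Ej E1 E2 E3]] := IH j; first by apply: leq_trans H; rewrite leq_addr.
have Hc : f k - G = 0.
  by move: H; rewrite /side_cost; case: eqP => // _; lia.
have [|Ha' S1 S2] := upd true y Ha; first by lia.
exists (fun i => if i == k then true else y i).
by rewrite !S1 !S2 /side_cost Hc eqxx !addn0 -E1 -E2 -E3.
Qed.

(** The recurrence keeps the smaller of its two candidates, and the candidate that follows [y k]
    carries no penalty because [y] is allowed. *)
Lemma table_complete G k y : allowed G k y ->
  second_load (table G k (scale + sum_if (negb \o y) (scaled G) k)) <= sum_if y u k.
Proof.
elim: k => [|k IH] Ha; first by rewrite /= !sum_if0 addn0 eqxx.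
have {}IH : second_load (table G k (scale + sum_if (negb \o y) (scaled G) k)) <= sum_if y u k.
  by apply: IH => i Hi; apply: Ha; apply: leqW.
have /= := Ha k (leqnn _); rewrite !sum_ifS /=.
rewrite [_ < scale]ltnNge leq_addr /= /second_load /side_cost.
case: (y k) => /= [Hf|[Hh Hw]].
  have -> : f k - G = 0 by lia.
  by rewrite eqxx addn0; case: ifP => E /=; rewrite /second_load in IH *; lia.
have -> : h k + (w k - G) = 0 by lia.
rewrite eqxx addnA addnK !addn0.
by case: ifP => E /=; rewrite /second_load in IH *; lia.
Qed.

(** This holds for any guess, right or wrong: first-side loads are stored unrounded, and [allowed]
    bounds the second-side delays by [G]. A bad guess can thus never record a false value. *)
Lemma table_feasible G j : second_load (table G L j) <= B ->
  exists y, [/\ feasible y, objective y <= maxn (first_load (table G L j)) G &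
    mask (table G L j) = sum_if y (expn 2) L].
Proof.
move=> H; have [y [Ha _ E1 E2 E3]] := table_sound H.
exists y; split=> //.
  by split; [move=> i /Ha Hi /negPf Ey; move: Hi; rewrite Ey => -[] | rewrite -E1].
rewrite /objective E2 geq_max leq_maxl /= leq_max; apply/orP; right.
by apply/bigmax_leqP => i _; have := Ha i (ltn_ord i); case: ifP.
Qed.

Lemma leq_sum_if (y : nat -> bool) g g' k : (forall i, i < k -> y i -> g i <= g' i) ->
  sum_if y g k <= sum_if y g' k.
Proof. by move=> H; apply: leq_sum => i _; case: ifP => // /H; apply. Qed.

Lemma sum_ifM y g c k : sum_if y (fun i => c * g i) k = c * sum_if y g k.
Proof.
rewrite /sum_if big_distrr; apply: eq_bigr => i _ /=; case: (y i) => //; by rewrite muln0.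
Qed.

Lemma sum_ifD y g g' k :
  sum_if y (fun i => g i + g' i) k = sum_if y g k + sum_if y g' k.
Proof. by rewrite /sum_if -big_split; apply: eq_bigr => i _; case: (y i). Qed.

Lemma sum_if_const y c k : sum_if y (fun=> c) k <= k * c.
Proof.
rewrite -[k in k * c]card_ord -sum_nat_const.
by apply: leq_sum => i _; case: ifP.
Qed.

(** The guess is the largest value that [y] pays for, and the cell is that of the scaled load of
    [y]. Rounding errs by at most [G / scale] per item, hence by [G / L] in total; [G] is at most
    the objective, and [m < L] turns the error into a factor [1 + 1 / m]. *)
Lemma table_approx m y : m < L -> 1 < L -> feasible y ->
  exists G v, [/\ exists2 i, i < L & (G = w i \/ G = f i), v < scale * scale,
    second_load (table G L (scale + v)) <= B &
    m * maxn (first_load (table G L (scale + v))) G <= m.+1 * objective y].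
Proof.
move=> Hm HL [Hh Hu].
pose g i := if y i then f i else w i.
have [i0 EG] : {i0 : 'I_L | \max_(i < L) g i = g i0}.
  by apply: eq_bigmax; rewrite card_ord; lia.
set G := \max_(i < L) g i in EG.
have HG i : i < L -> g i <= G.
  by move=> Hi; apply: (leq_bigmax (F := fun i : 'I_L => g i) (Ordinal Hi)).
have HGo : G <= objective y.
  rewrite EG /g /objective leq_max; case: ifP => Hy; apply/orP; [right|left].
    by have := leq_bigmax (F := fun i : 'I_L => if y i then f i else 0) i0; rewrite Hy.
  by rewrite /sum_if (bigD1 i0) //= Hy leq_addr.
have Ha : allowed G L y.
  by move=> i Hi; have := HG i Hi; have := Hh i Hi; rewrite /g; case: (y i) => //=; auto.
(* The scaled load is at most [L^3], which is below [L^4] because [1 < L]. *)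
have Hv : sum_if (negb \o y) (scaled G) L < scale * scale.
  apply: (@leq_ltn_trans (L * scale)).
    apply: leq_trans (sum_if_const (negb \o y) scale L).
    by apply: leq_sum_if => i _ _; apply: scaled_le.
  by rewrite ltn_mul2r /scale; nia.
exists G, (sum_if (negb \o y) (scaled G) L); split=> //.
- by exists i0 => //; rewrite EG /g; case: ifP; auto.
- exact: leq_trans (table_complete Ha) Hu.
(* The cell may store an assignment [y'] other than [y]; cancelling the offset [scale] shows that
   both have the same scaled load. *)
have [|y' [Ha' /addnI Ev _ -> _]] := @table_sound G L (scale + sum_if (negb \o y) (scaled G) L).
  exact: leq_trans (table_complete Ha) Hu.
have H1 : scale * sum_if (negb \o y') w L <= G * sum_if (negb \o y') (scaled G) L + L * G.
  rewrite -!sum_ifM; apply: leq_trans (leq_add (leqnn _) (sum_if_const (negb \o y') G L)).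
  rewrite -sum_ifD; apply: leq_sum_if => i Hi /= Hy; apply: le_mul_scaled.
  by have := Ha' i Hi; rewrite (negPf Hy) => -[].
have H2 : G * sum_if (negb \o y) (scaled G) L <= scale * sum_if (negb \o y) w L.
  by rewrite -!sum_ifM; apply: leq_sum_if => i _ _; apply: mul_scaled_le.
have Hw : sum_if (negb \o y) w L <= objective y by rewrite leq_maxl.
move: (sum_if _ w L) (sum_if _ w L) (objective y) H1 H2 Hw HGo => b a o; rewrite -Ev.
move=> H1 H2 Hb HGo.
(* [H1] and [H2] together give [scale * a <= scale * b + L * G], and one factor [L] cancels. *)
have H3 : L * a <= L * b + G.
  have L0 : 0 < L by lia.
  by rewrite -(leq_pmul2l L0) mulnDr !mulnA -/scale; lia.
rewrite maxnMr geq_max; apply/andP; split; last by nia.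
case: (leqP a b) => Hab; first by nia.
have : m * (a - b) <= G by apply: (@leq_trans (L * (a - b)));
  [rewrite leq_mul2r; lia | rewrite mulnBr; lia].
rewrite mulnBr; nia.
Qed.

End TwoSided.

(** * The approximation scheme as a program *)

Notation "c1 ;; c2" := (Seq c1 c2) (at level 60, right associativity).
Notation Var k := (Arr k (Cst 0)).
Notation SetV k e := (Put k (Cst 0) e).

(** Nesting [k] loops gives [L^k] iterations, so every polynomial range is traversed with the single
    bound [L]. *)
Definition rep (k : nat) (c : cmd) : cmd := iter k For c.

Lemma mods_rep k c : mods (rep k c) = mods c.
Proof. by elim: k. Qed.

Lemma iterM (T : Type) (g : T -> T) a b x :
  iter a (iter b g) x = iter (a * b) g x.
Proof. by elim: a => //= a ->; rewrite mulSn iterD. Qed.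

Lemma sem_rep k c s : 1 \notin mods c ->
  sem (rep k c) s = iter (s 1 0 ^ k) (sem c) s.
Proof.
move=> Hm; elim: k s => [|k IH] s //=.
have F a : iter a (sem (rep k c)) s 1 0 = s 1 0.
  by elim: a => //= a <-; rewrite sem_frame // mods_rep.
rewrite expnS -iterM.
suff H n : iter n (sem (rep k c)) s = iter n (iter (s 1 0 ^ k) (sem c)) s by exact: H.
by elim: n => //= n <-; rewrite IH F.
Qed.

Lemma sem_frame_in (l : seq nat) c s k i : all [in l] (mods c) -> k \notin l ->
  sem c s k i = s k i.
Proof.
by move=> /allP Hl Hk; apply: sem_frame; apply/negP => /Hl; apply/negP.
Qed.

(** An invariant rule in which cells outside [mods c] keep their initial values for free, so that
    invariants mention only what the body changes. *)
Lemma iter_sem_ind c (I : nat -> env -> Prop) n s : I 0 s ->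
  (forall t s', t < n -> (forall k i, k \notin mods c -> s' k i = s k i) ->
    I t s' -> I t.+1 (sem c s')) ->
  I n (iter n (sem c) s).
Proof.
move=> H0 HS; suff : (forall k i, k \notin mods c -> iter n (sem c) s k i = s k i) /\
  I n (iter n (sem c) s) by case.
elim: n HS => [|n IH] HS //=; have [|F Hn] := IH.
  by move=> t s' Ht; apply: HS; apply: ltnW.
split; last exact: HS.
by move=> k i Hk; rewrite sem_frame ?F.
Qed.

Lemma rep_ind k c n (I : nat -> env -> Prop) s : 1 \notin mods c ->
  s 1 0 ^ k = n -> I 0 s ->
  (forall t s', t < n -> (forall k i, k \notin mods c -> s' k i = s k i) ->
    I t s' -> I t.+1 (sem c s')) ->
  I n (sem (rep k c) s).
Proof. by move=> Hm <- H0 HS; rewrite sem_rep //; apply: iter_sem_ind. Qed.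

Lemma sem_skip s : sem Skip s = s.
Proof. by []. Qed.

Lemma sem_put k e1 e2 s : sem (Put k e1 e2) s = put s k (eval s e1) (eval s e2).
Proof. by []. Qed.

Lemma sem_seq c1 c2 s : sem (c1 ;; c2) s = sem c2 (sem c1 s).
Proof. by []. Qed.

Lemma sem_if e c1 c2 s :
  sem (If e c1 c2) s = if eval s e == 0 then sem c1 s else sem c2 s.
Proof. by []. Qed.

Definition semE := (sem_skip, sem_put, sem_seq, sem_if).

Arguments sem : simpl never.

(* Arrays: 0 input, 1 loop bound, 2-5 item data w, u, h, f, 6 powers of 2,
   7-9 dynamic-programming table, 10 output; the others hold scalars. *)
Definition scale_cmd : cmd :=
  SetV 14 (Cst 0) ;;
  rep 2 (SetV 14 (Plus (Var 14) (Arr 2 (Var 11)))) ;;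
  SetV 15 (Cst 0) ;; SetV 16 (Cst 0) ;;
  rep 2 (SetV 15 (Plus (Var 15) (Var 12)) ;;
         SetV 16 (Plus (Var 16) (Minus (Cst 1) (Minus (Var 15) (Var 14))))).

(** Scalar 19 is the current cell, 11 the current item, 12 the guess, 13 the item it comes from, 16
    the scaled load, 17 and 18 the two side costs. The load [B.+1] marks an empty cell. *)
Definition blank_cmd : cmd :=
  Put 7 (Var 19) (Plus (Arr 0 (Cst 0)) (Cst 1)) ;; Put 8 (Var 19) (Cst 0) ;;
  Put 9 (Var 19) (Cst 0) ;; SetV 19 (Plus (Var 19) (Cst 1)).

(** The first [L^2] cells fix the offset [scale], kept in scalar 20; the next [L^4] are for the
    scaled loads, and scalar 21 keeps the end. *)
Definition init_cmd : cmd :=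
  SetV 19 (Cst 0) ;; rep 2 blank_cmd ;; SetV 20 (Var 19) ;; rep 4 blank_cmd ;;
  SetV 21 (Var 19) ;; Put 7 (Var 20) (Cst 0).

(** The table is updated in place. The sweep goes downwards, so the lower cell that is consulted
    still holds the previous row, and each entry is read before it is overwritten. *)
Definition relax_cmd : cmd :=
  SetV 19 (Minus (Var 19) (Cst 1)) ;;
  SetV 24 (Plus (Arr 7 (Minus (Var 19) (Var 16))) (Var 17)) ;;
  SetV 25 (Plus (Arr 7 (Var 19)) (Var 18)) ;;
  If (Minus (Var 24) (Var 25))
    (Put 8 (Var 19) (Plus (Arr 8 (Minus (Var 19) (Var 16))) (Arr 2 (Var 11))) ;;
     Put 9 (Var 19) (Arr 9 (Minus (Var 19) (Var 16))) ;;
     Put 7 (Var 19) (Var 24))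
    (Put 9 (Var 19) (Plus (Arr 9 (Var 19)) (Arr 6 (Var 11))) ;;
     Put 7 (Var 19) (Var 25)).

Definition row_cmd : cmd :=
  scale_cmd ;;
  If (Plus (Arr 4 (Var 11)) (Minus (Arr 2 (Var 11)) (Var 12)))
    (SetV 17 (Cst 0)) (SetV 17 (Plus (Arr 0 (Cst 0)) (Cst 1))) ;;
  If (Minus (Arr 5 (Var 11)) (Var 12))
    (SetV 18 (Arr 3 (Var 11))) (SetV 18 (Plus (Arr 0 (Cst 0)) (Cst 1))) ;;
  SetV 19 (Var 21) ;; rep 4 relax_cmd ;; SetV 11 (Plus (Var 11) (Cst 1)).

(** Scalar 22 is the best value so far plus one, 0 meaning none, and 23 its mask. For old [b] and
    new [v] the inner test computes [minn b (v - b)], which is 0 exactly when nothing is recorded or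
    [v <= b]. *)
Definition scan_cmd : cmd :=
  SetV 19 (Minus (Var 19) (Cst 1)) ;;
  If (Minus (Arr 7 (Var 19)) (Arr 0 (Cst 0)))
    (SetV 29 (Plus (Plus (Var 12) (Minus (Arr 8 (Var 19)) (Var 12))) (Cst 1)) ;;
     If (Minus (Var 22) (Minus (Var 22) (Minus (Var 29) (Var 22))))
       (SetV 22 (Var 29) ;; SetV 23 (Arr 9 (Var 19))) Skip)
    Skip.

Definition guess_cmd : cmd :=
  init_cmd ;; SetV 11 (Cst 0) ;; For row_cmd ;; SetV 19 (Var 21) ;; rep 4 scan_cmd.

Definition search_cmd : cmd :=
  SetV 22 (Cst 0) ;; SetV 13 (Cst 0) ;;
  For (SetV 12 (Arr 2 (Var 13)) ;; guess_cmd ;;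
       SetV 12 (Arr 5 (Var 13)) ;; guess_cmd ;;
       SetV 13 (Plus (Var 13) (Cst 1))).

Lemma putE s k i v k' i' :
  put s k i v k' i' = if (k' == k) && (i' == i) then v else s k' i'.
Proof. by []. Qed.

(** * Correctness of the search over guesses *)

Section Search.

Variables (w u h f : nat -> nat) (B L : nat).

Definition data (s : env) : Prop :=
  [/\ s 1 0 = L, s 0 0 = B,
      forall i, i < L -> [/\ s 2 i = w i, s 3 i = u i, s 4 i = h i & s 5 i = f i] &
      forall i, i < L -> s 6 i = 2 ^ i].

Lemma data_eq s s' : (forall k i, k < 7 -> s' k i = s k i) -> data s -> data s'.
Proof.
move=> E [H1 H2 H3 H4]; split; rewrite ?E // => i Hi; rewrite !E ?H4 //.
exact: H3.
Qed.

Lemma data_frame c s : all (leq 7) (mods c) -> data s -> data (sem c s).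
Proof.
move=> /allP Hc; apply: data_eq => k i Hk; apply: sem_frame.
by apply/negP => /Hc; rewrite leqNgt Hk.
Qed.

Definition cell_of (s : env) (j : nat) : cell := (s 7 j, s 8 j, s 9 j).

Lemma pow2N : L ^ 2 = scale L.
Proof. by rewrite expnS expn1. Qed.

Lemma pow4N : L ^ 4 = scale L * scale L.
Proof. by rewrite -pow2N -expnD. Qed.

Lemma scale_ok s : data s -> s 11 0 < L ->
  sem scale_cmd s 16 0 = scaled w L (s 12 0) (s 11 0).
Proof.
move=> [HL _ Hd _] Hi; have [Hw _ _ _] := Hd _ Hi.
rewrite /scale_cmd !sem_seq; set s1 := sem (SetV 14 (Cst 0)) s.
set s2 := sem (rep 2 _) s1.
have F1 k i : k != 14 -> s1 k i = s k i by rewrite /s1 sem_put putE => /negPf ->.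
have F2 k i : k != 14 -> s2 k i = s k i.
  by move=> Hk; rewrite /s2 sem_frame ?F1 // mods_rep /= inE.
have E2 : s2 14 0 = scale L * w (s 11 0).
  apply: (@rep_ind 2 _ (scale L) (fun t s' => s' 14 0 = t * w (s 11 0))) => //.
    by rewrite F1 // HL pow2N.
  move=> t s' _ F E.
  by rewrite !semE putE /= E !F // !F1 // Hw mulSn addnC.
set s3 := sem _ s2; set s4 := sem _ s3.
have F4 k i : k \notin [:: 14; 15; 16] -> s4 k i = s k i.
  rewrite !inE !negb_or => /and3P[H1 H2 H3].
  by rewrite /s4 /s3 !sem_put !putE (negPf H2) (negPf H3) F2.
have E4 : s4 14 0 = scale L * w (s 11 0) by rewrite /s4 /s3 !sem_put !putE E2.
have HL4 : s4 1 0 = L by rewrite F4.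
suff [] : sem (rep 2 (SetV 15 (Plus (Var 15) (Var 12)) ;;
         SetV 16 (Plus (Var 16) (Minus (Cst 1) (Minus (Var 15) (Var 14)))))) s4 15 0 =
      scale L * s 12 0 /\
    sem (rep 2 (SetV 15 (Plus (Var 15) (Var 12)) ;;
         SetV 16 (Plus (Var 16) (Minus (Cst 1) (Minus (Var 15) (Var 14)))))) s4 16 0 =
      scaled_upto w L (s 12 0) (s 11 0) (scale L) by [].
apply: (@rep_ind 2 _ (scale L) (fun t s' => s' 15 0 = t * s 12 0 /\
   s' 16 0 = scaled_upto w L (s 12 0) (s 11 0) t)) => //.
- by rewrite HL4 pow2N.
- by rewrite /scaled_upto big_ord0.
- move=> t s' _ F [E15 E16]; rewrite !semE /= !putE /= E15 E16 !F // E4 F4 //.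
  by rewrite scaled_uptoS mulSn addnC.
Qed.

Lemma blank_loop k s : s 1 0 = L -> s 0 0 = B ->
  let s' := sem (rep k blank_cmd) s in
  s' 19 0 = s 19 0 + L ^ k /\
  forall j, cell_of s' j = if s 19 0 <= j < s 19 0 + L ^ k then (B.+1, 0, 0) else cell_of s j.
Proof.
move=> HL HB /=.
apply: (@rep_ind k _ (L ^ k) (fun t s' => s' 19 0 = s 19 0 + t /\ forall j, cell_of s' j =
  if s 19 0 <= j < s 19 0 + t then (B.+1, 0, 0) else cell_of s j)) => //.
- by rewrite HL.
- by rewrite addn0; split=> // j; case: ifP => //; lia.
move=> t s' _ F [Ej Ec]; rewrite /blank_cmd !semE; split=> [|j].
  by rewrite /= !putE /= Ej; lia.
rewrite /cell_of /= !putE /= Ej F // HB.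
case: (ltngtP j (s 19 0 + t)) => Hj.
- rewrite -/(cell_of s' j) Ec; case: ifP; case: ifP => //; lia.
- by rewrite -/(cell_of s' j) Ec; case: ifP; case: ifP => //; lia.
- by rewrite addn1 Hj ifT //; lia.
Qed.

Lemma init_ok s : s 1 0 = L -> s 0 0 = B ->
  let s' := sem init_cmd s in
  s' 21 0 = scale L + scale L * scale L /\
  forall j G, j < scale L + scale L * scale L -> cell_of s' j = table w u h f B L G 0 j.
Proof.
move=> HL HB; rewrite /init_cmd !semE /=.
set s1 := put s 19 0 0.
have [|//|E1 C1] := @blank_loop 2 s1; first by [].
set s2 := sem (rep 2 _) s1 in E1 C1 *.
have F2 k i : k < 7 -> s2 k i = s k i.
  move=> Hk; rewrite /s2 sem_frame; last by rewrite mods_rep /= !inE; lia.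
  by rewrite /s1 putE; case: (k =P 19) => // Ek; move: Hk; rewrite Ek.
set s3 := put s2 20 0 _.
have HL3 : s3 1 0 = L by rewrite /s3 putE /= F2.
have HB3 : s3 0 0 = B by rewrite /s3 putE /= F2.
have [E3 C3] := blank_loop 4 HL3 HB3.
set s4 := sem (rep 4 _) s3 in E3 C3 *.
have E20 : s4 20 0 = scale L by rewrite /s4 sem_frame ?mods_rep // /s3 putE /= E1 pow2N.
have E3' : s4 19 0 = scale L + scale L * scale L.
  by rewrite E3 /s3 !putE /= E1 pow2N pow4N.
split=> [|j G Hj]; first by rewrite !putE /= E3'.
rewrite /cell_of !putE /= E20.
have C : cell_of s4 j = (B.+1, 0, 0).
  rewrite C3 /s3 putE /= E1 pow2N pow4N; case: ifP => // H.
  by rewrite -/(cell_of s2 j) /cell_of !putE /= -/(cell_of s2 j) C1 pow2N ifT //;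
    move: H Hj; rewrite /s1 /=; lia.
by case: C => -> -> ->; case: eqP.
Qed.

Lemma relax_ok G k s : data s -> k < L -> s 11 0 = k ->
  s 16 0 = scaled w L G k -> s 17 0 = side_cost B (h k + (w k - G)) 0 ->
  s 18 0 = side_cost B (f k - G) (u k) -> s 19 0 = scale L + scale L * scale L ->
  (forall j, j < scale L + scale L * scale L -> cell_of s j = table w u h f B L G k j) ->
  forall j, j < scale L + scale L * scale L ->
    cell_of (sem (rep 4 relax_cmd) s) j = table w u h f B L G k.+1 j.
Proof.
move=> [HL _ Hd Hp] Hk E11 E16 E17 E18 E19 Hc.
set tot := scale L + _ in E19 Hc *.
have [Hw _ _ _] := Hd _ Hk; have Hpk := Hp _ Hk.
(* After [t] steps the top [t] cells belong to row [k.+1] and the others to row [k]. The [L^4] steps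
   end at cell [scale]; the cells below it are the same in both rows. *)
pose I (t : nat) (s' : env) : Prop := s' 19 0 = tot - t /\ forall j, j < tot ->
    cell_of s' j = table w u h f B L G (if j < tot - t then k else k.+1) j.
suff [_ H] : I
    (scale L * scale L) (sem (rep 4 relax_cmd) s).
  move=> j Hj; rewrite H // addnK; case: ifP => // HjN.
  by rewrite /= HjN.
apply: (@rep_ind 4 _ _ I) => //.
- by rewrite HL pow4N.
- by rewrite /I subn0 E19; split=> // j Hj; rewrite Hj Hc.
move=> t s' Ht F [Ej Ec].
have Hsc := scaled_le w L G k.
have Htot : tot = scale L + scale L * scale L by [].
set j0 := tot - t.+1.
have Hj0 : s' 19 0 - 1 = j0 by rewrite Ej /j0; lia.
have C0 : cell_of s' j0 = table w u h f B L G k j0.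
  by rewrite Ec ?ifT // /j0; lia.
have C1 : cell_of s' (j0 - scaled w L G k) =
    table w u h f B L G k (j0 - scaled w L G k).
  by rewrite Ec ?ifT // /j0; lia.
pose xs := s' 7 (j0 - scaled w L G k) + side_cost B (h k + (w k - G)) 0.
pose ys := s' 7 j0 + side_cost B (f k - G) (u k).
have {E11} E11 : s' 11 0 = k by rewrite F.
have {E16} E16 : s' 16 0 = scaled w L G k by rewrite F.
have {E17} E17 : s' 17 0 = side_cost B (h k + (w k - G)) 0 by rewrite F.
have {E18} E18 : s' 18 0 = side_cost B (f k - G) (u k) by rewrite F.
have {Hw} Hw : s' 2 k = w k by rewrite F.
have {Hpk} Hpk : s' 6 k = 2 ^ k by rewrite F.
rewrite /relax_cmd sem_seq sem_put [eval _ (Cst 0)]/= [eval s' _]/= Hj0.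
set s1 := put s' 19 0 j0; rewrite sem_seq sem_put [eval _ (Cst 0)]/=.
have -> : eval s1 (Plus (Arr 7 (Minus (Var 19) (Var 16))) (Var 17)) = xs.
  by rewrite /= /s1 !putE /= E16 E17.
set s2 := put s1 24 0 xs; rewrite sem_seq sem_put [eval _ (Cst 0)]/=.
have -> : eval s2 (Plus (Arr 7 (Var 19)) (Var 18)) = ys.
  by rewrite /= /s2 /s1 !putE /= E18.
set s3 := put s2 25 0 ys.
have F3 a i : a \notin [:: 19; 24; 25] -> s3 a i = s' a i.
  by rewrite !inE !negb_or => /and3P[/negPf H1 /negPf H2 /negPf H3];
    rewrite /s3 /s2 /s1 !putE H1 H2 H3.
have [T1 T2 T3] : [/\ s3 19 0 = j0, s3 24 0 = xs & s3 25 0 = ys] by [].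
rewrite sem_if [eval _ (Minus _ _)]/= T2 T3.
move: s3 F3 T1 T2 T3 => {s1 s2} s3 F3 T1 T2 T3.
(* Both branches are summarised in one description of the new memory: only cell [j0] of arrays 7 to
   9 changes. *)
have D a i : (if xs - ys == 0 then
      sem (Put 8 (Var 19) (Plus (Arr 8 (Minus (Var 19) (Var 16))) (Arr 2 (Var 11))) ;;
        Put 9 (Var 19) (Arr 9 (Minus (Var 19) (Var 16))) ;; Put 7 (Var 19) (Var 24)) s3
    else sem (Put 9 (Var 19) (Plus (Arr 9 (Var 19)) (Arr 6 (Var 11))) ;;
        Put 7 (Var 19) (Var 25)) s3) a i =
  if i == j0 then
    if a == 7 then if xs - ys == 0 then xs else ys
    else if a == 8 then if xs - ys == 0 then s' 8 (j0 - scaled w L G k) + w k else s3 8 i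
    else if a == 9 then
      if xs - ys == 0 then s' 9 (j0 - scaled w L G k) else s' 9 j0 + 2 ^ k
    else s3 a i
  else s3 a i.
  have F9 x : s3 9 x = s' 9 x by rewrite F3.
  have F8 x : s3 8 x = s' 8 x by rewrite F3.
  have [V1 V2 V3 V4] : [/\ s3 11 0 = k, s3 16 0 = scaled w L G k, s3 2 k = w k & s3 6 k = 2 ^ k].
    by rewrite !F3.
  case: ifP => _; rewrite !semE /= !putE /= T1 ?T2 ?T3 V1 ?V2 ?V3 ?V4.
    case: (i =P j0) => [->|_]; rewrite ?andbF //= ?andbT F8 F9.
    by case: (a =P 8) => [->|].
  case: (i =P j0) => [->|_]; rewrite ?andbF //= ?andbT F9.
  by case: (a =P 8) => [->|].
rewrite /I; split; first by rewrite D /= if_same T1.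
move=> j Hj.
have -> : (if j < j0 then k else k.+1) = if j == j0 then k.+1 else
    if j < tot - t then k else k.+1.
  by case: (j =P j0) => [->|Hne]; [rewrite ltnn | case: ifP; case: ifP => //; rewrite /j0; lia].
case: (j =P j0) => [->|/eqP/negPf Hne]; last first.
  by rewrite -Ec // /cell_of !D Hne !F3.
rewrite /=; have -> : j0 < scale L = false by rewrite /j0; lia.
rewrite -C0 -C1 /second_load /first_load /mask /cell_of /= !D eqxx /= -/xs -/ys F3 //.
by case: ifP.
Qed.

Arguments table : simpl never.

Lemma row_ok k s : data s -> k < L -> s 11 0 = k -> s 21 0 = scale L + scale L * scale L ->
  (forall j, j < scale L + scale L * scale L -> cell_of s j = table w u h f B L (s 12 0) k j) ->
  s 11 0 < L /\
  let s' := sem row_cmd s in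
  s' 11 0 = k.+1 /\ forall j, j < scale L + scale L * scale L ->
    cell_of s' j = table w u h f B L (s 12 0) k.+1 j.
Proof.
move=> Hd Hk E11 E21 Hc; split; first by rewrite E11.
set s1 := sem scale_cmd s.
have F1 a i : a \notin [:: 14; 15; 16] -> s1 a i = s a i.
  exact: sem_frame_in.
have E16 : s1 16 0 = scaled w L (s 12 0) k by rewrite /s1 scale_ok // E11.
have [HL HB Hwd Hp] := Hd; have [Hw Hu Hh Hf] := Hwd _ Hk.
have [V11 V12 V21 VB] : [/\ s1 11 0 = k, s1 12 0 = s 12 0, s1 21 0 = s 21 0 & s1 0 0 = B].
  by rewrite !F1.
have [V2 V3 V4 V5] : [/\ s1 2 k = w k, s1 3 k = u k, s1 4 k = h k & s1 5 k = f k].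
  by rewrite !F1.
rewrite /row_cmd [sem (_ ;; _) s]sem_seq -/s1 sem_seq; set s2 := sem (If _ _ _) s1.
have E2 a i : s2 a i = if (a == 17) && (i == 0)
    then side_cost B (h k + (w k - s 12 0)) 0 else s1 a i.
  rewrite /s2 sem_if /= V11 V12 V4 V2 /side_cost.
  by case: ifP => _; rewrite sem_put putE //= VB addn1.
have [X11 X12 XB] : [/\ s2 11 0 = k, s2 12 0 = s 12 0 & s2 0 0 = B] by rewrite !E2.
have [X3 X5] : s2 3 k = u k /\ s2 5 k = f k by rewrite !E2.
rewrite sem_seq; set s3 := sem (If _ _ _) s2.
have E3 a i : s3 a i = if (a == 18) && (i == 0)
    then side_cost B (f k - s 12 0) (u k) else s2 a i.
  rewrite /s3 sem_if /= X11 X12 X5 /side_cost.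
  by case: ifP => _; rewrite sem_put putE /= ?X11 ?X3 ?XB ?addn1.
rewrite !semE /=; set s4 := put s3 19 0 _.
have E4 a i : a \notin [:: 14; 15; 16; 17; 18; 19] -> s4 a i = s a i.
  rewrite !inE !negb_or => /and5P[H1 H2 H3 H4 /andP[H5 H6]].
  by rewrite /s4 putE (negPf H6) /= E3 (negPf H5) /= E2 (negPf H4) /= F1 // !inE !negb_or H1 H2 H3.
split.
  rewrite putE /= sem_frame ?mods_rep // E4 // E11 addn1 //.
move=> j Hj.
rewrite -(@relax_ok (s 12 0) k s4) //.
- by apply: data_eq Hd => a i Ha; rewrite E4 // !inE; lia.
- by rewrite E4.
- by rewrite /s4 putE /= E3 /= E2.
- by rewrite /s4 putE /= E3 /= E2.
- by rewrite /s4 putE /= E3.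
- by rewrite /s4 putE /= E3 /= E2 /= V21.
- by move=> j' Hj'; rewrite /cell_of !E4 // -Hc.
Qed.

(** Either nothing is recorded, or the mask belongs to a feasible assignment; the inequality is
    strict because scalar 22 is shifted by one. *)
Definition solved (s : env) : Prop := s 22 0 = 0 \/
  exists y, [/\ feasible u h B L y, objective w f L y < s 22 0 &
    s 23 0 = sum_if y (expn 2) L].

(** Some value of at most [v] has been recorded, again up to the shift by one. *)
Definition covers (s : env) (v : nat) : Prop := 0 < s 22 0 <= v.+1.

Lemma scan_ok G s : data s -> s 12 0 = G -> s 19 0 = scale L + scale L * scale L ->
  (forall j, j < scale L + scale L * scale L -> cell_of s j = table w u h f B L G L j) ->
  solved s ->
  let s' := sem (rep 4 scan_cmd) s in
  [/\ solved s', forall v, covers s v -> covers s' v &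
    forall v, v < scale L * scale L ->
      let c := table w u h f B L G L (scale L + v) in
      second_load c <= B -> covers s' (maxn (first_load c) G)].
Proof.
move=> [HL HB _ _] E12 E19 Hc Hs; set tot := scale L + _ in E19 Hc *.
pose I (t : nat) (s' : env) : Prop := s' 19 0 = tot - t /\
  [/\ solved s', forall v, covers s v -> covers s' v &
    forall j, tot - t <= j < tot ->
      let c := table w u h f B L G L j in
      second_load c <= B -> covers s' (maxn (first_load c) G)].
suff [_ [H1 H2 H3]] : I
    (scale L * scale L) (sem (rep 4 scan_cmd) s).
  split=> // v Hv; apply: H3; rewrite /tot; lia.
apply: (@rep_ind 4 _ _ I) => //.
- by rewrite HL pow4N.
- by rewrite /I subn0 E19; split=> //; split=> // j; lia.
move=> t s' Ht F [Ej [I1 I2 I3]].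
have Htot : tot = scale L + scale L * scale L by [].
set j0 := tot - t.+1.
have Hj0 : s' 19 0 - 1 = j0 by rewrite Ej /j0; lia.
have C0 : (s' 7 j0, s' 8 j0, s' 9 j0) = table w u h f B L G L j0.
  by rewrite !F // -Hc // /j0; lia.
rewrite /scan_cmd sem_seq sem_put [eval _ (Cst 0)]/= [eval s' _]/= Hj0 !semE /= !putE /=.
have -> : s' 0 0 = B by rewrite F.
have -> : s' 12 0 = G by rewrite F.
have Hstep v : (tot - t.+1 <= v < tot) -> v = j0 \/ tot - t <= v < tot.
  by rewrite /j0; lia.
case: ifP => [Hload|Hload]; last first.
  split; first by rewrite !putE.
  split=> // j /Hstep [->|Hj] /= Hl; last exact: I3.
  by move: Hl Hload; rewrite -C0 /second_load /=; lia.
have Eval : G + (s' 8 j0 - G) + 1 = (maxn (first_load (s' 7 j0, s' 8 j0, s' 9 j0)) G).+1.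
  by rewrite /first_load /=; lia.
rewrite Eval C0; set val := maxn _ _.
case: ifP => Hbest.
  split; first by rewrite !putE.
  have cov v : covers s' v \/ v = val -> covers (put (put (put (put s' 19 0 j0) 29 0 val.+1)
      22 0 val.+1) 23 0 (s' 9 j0)) v.
    by rewrite /covers !putE /=; move: Hbest; lia.
  split.
  - right; have [|y [Hy1 Hy2 Hy3]] := @table_feasible w u h f B L G j0.
      by move: Hload; rewrite -C0 /second_load /=; lia.
    exists y; rewrite !putE /=; split=> //.
    by rewrite -Hy3 -C0.
  - by move=> v Hv; apply: cov; left; apply: I2.
  - move=> j /Hstep [->|Hj] /= Hl; apply: cov; [by right | left; exact: I3].
split; first by rewrite !putE.
split=> // j /Hstep [->|Hj] /= Hl; last exact: I3.
by rewrite -/val /covers !putE /=; move: Hbest; lia.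
Qed.

Lemma guess_ok s : data s -> solved s ->
  let s' := sem guess_cmd s in
  [/\ data s', solved s', forall v, covers s v -> covers s' v &
    forall v, v < scale L * scale L ->
      let c := table w u h f B L (s 12 0) L (scale L + v) in
      second_load c <= B -> covers s' (maxn (first_load c) (s 12 0))].
Proof.
move=> Hd Hs; set s0 := sem init_cmd s; have [HL HB _ _] := Hd.
have [E21 Hc] := init_ok HL HB; rewrite -/s0 in E21 Hc.
have F0 a i : a \notin [:: 7; 8; 9; 19; 20; 21] -> s0 a i = s a i.
  exact: sem_frame_in.
have Hd0 : data s0 by apply: data_eq Hd => k i Hk; rewrite F0 // !inE; lia.
rewrite /guess_cmd 4!sem_seq -/s0 ![sem (SetV _ _) _]sem_put.
set s1 := put s0 11 0 _; set s2 := sem (For row_cmd) s1.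
have F1 a i : a != 11 -> s1 a i = s0 a i by rewrite /s1 putE => /negPf ->.
have [Hd2 E2] : data s2 /\ forall j, j < scale L + scale L * scale L ->
    cell_of s2 j = table w u h f B L (s 12 0) L j.
  have Hm a : a \in mods row_cmd -> (6 < a) && (a \notin [:: 12; 21; 22; 23]).
    by have /allP : all (fun a => (6 < a) && (a \notin [:: 12; 21; 22; 23])) (mods row_cmd)
      by []; apply.
  have Fm (a i : nat) (s' s'' : env) : (forall k i, k \notin mods row_cmd -> s'' k i = s' k i) ->
      (a < 7) || (a \in [:: 12; 21; 22; 23]) -> s'' a i = s' a i.
    by move=> H Ha; apply: H; apply/negP => /Hm; move: Ha; rewrite !inE; lia.
  pose I (t : nat) (s' : env) : Prop := s' 11 0 = t /\ forall j, j < scale L + scale L * scale L ->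
      cell_of s' j = table w u h f B L (s 12 0) t j.
  suff [H1 H2] : I L s2.
    split=> //; apply: data_eq Hd0 => a i Ha.
    rewrite (@Fm a i s1) ?Ha //; first by rewrite F1 //; lia.
    by move=> k i' Hk; apply: sem_frame.
  apply: (@rep_ind 1 _ _ I) => //.
  - by rewrite expn1 F1 // F0.
  - by split=> // j Hj; rewrite /cell_of !F1 // -Hc.
  move=> t s' Ht F [E11 Ec].
  have F' a i : a != 11 -> (a < 7) || (a \in [:: 12; 21; 22; 23]) -> s' a i = s0 a i.
    by move=> H1 Ha; rewrite (@Fm a i s1) // F1.
  have E12 : s' 12 0 = s 12 0 by rewrite F' // F0.
  have [|||_ /=] := @row_ok t s' _ Ht E11; rewrite ?E12 //.
  - by apply: data_eq Hd0 => a i Ha; rewrite F' ?Ha //; lia.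
  - by rewrite F'.
have F2 a i : a \in [:: 12; 13; 21; 22; 23] -> s2 a i = s0 a i.
  move=> Ha; rewrite /s2 sem_frame ?F1 //; first by move: Ha; rewrite !inE; lia.
  apply: contraL Ha => Ha;
  have /allP : all (fun a => a \notin [:: 12; 13; 21; 22; 23]) (mods row_cmd) by [].
  exact.
set s3 := put s2 19 0 _.
have F3 a i : a != 19 -> s3 a i = s2 a i by rewrite /s3 putE => /negPf ->.
have E22 : s3 22 0 = s 22 0 by rewrite F3 // F2 // F0.
have E23 : s3 23 0 = s 23 0 by rewrite F3 // F2 // F0.
have Hd3 : data s3 by apply: data_eq Hd2 => a i Ha; rewrite F3 //; lia.
have [||||H1 H2 H3] := @scan_ok (s 12 0) s3 Hd3.
- by rewrite F3 // F2 // F0.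
- by rewrite /s3 putE /= F2.
- by move=> j Hj; rewrite /cell_of !F3 // -E2.
- by rewrite /solved E22 E23.
split=> //; first by apply: data_frame Hd3.
by move=> v; rewrite /covers -E22; apply: H2.
Qed.

Lemma covers_put s k x v : k != 22 -> covers s v -> covers (put s k 0 x) v.
Proof. by rewrite /covers putE eq_sym => /negPf ->. Qed.

Lemma solved_put s k x : k != 22 -> k != 23 -> solved s -> solved (put s k 0 x).
Proof.
by move=> /negPf H1 /negPf H2; rewrite /solved !putE ![_ == k]eq_sym H1 H2.
Qed.

(** Recorded values only decrease, so [covers] is preserved by later guesses, and in the end it
    holds for every guess taken from an item and every cell. *)
Lemma search_ok s : data s ->
  let s' := sem search_cmd s in
  solved s' /\ forall i G v, i < L -> G = w i \/ G = f i -> v < scale L * scale L ->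
      let c := table w u h f B L G L (scale L + v) in
      second_load c <= B -> covers s' (maxn (first_load c) G).
Proof.
move=> Hd; rewrite /search_cmd !sem_seq ![sem (SetV _ _) _]sem_put.
set s1 := put _ 13 0 _; set c := For _.
have Hd1 : data s1.
  apply: data_eq Hd => k i Hk; rewrite /s1 !putE.
  by case: eqP => [Ek|_] /=; [move: Hk; rewrite Ek | case: eqP => [Ek|_] //; move: Hk; rewrite Ek].
pose I (t : nat) (s' : env) : Prop := [/\ s' 13 0 = t, data s', solved s' &
    forall i G v, i < t -> G = w i \/ G = f i -> v < scale L * scale L ->
      let c := table w u h f B L G L (scale L + v) in
      second_load c <= B -> covers s' (maxn (first_load c) G)].
suff [_ _ H1 H2] : I L (sem c s1) by [].
apply: (@rep_ind 1 _ _ I) => //.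
- by have [HL _ _ _] := Hd1; rewrite expn1.
- by split=> //; left.
move=> t s' Ht _ [E13 Hd' Hs' Hc'].
have [HL _ Hwf _] := Hd'; have [Hw _ _ Hf] := Hwf _ Ht.
rewrite 4!sem_seq ![sem (SetV _ _) _]sem_put.
set s2 := put s' 12 0 _; set s3 := sem guess_cmd s2; set s4 := put s3 12 0 _.
set s5 := sem guess_cmd s4.
have Hdput s0 v k : 6 < k -> data s0 -> data (put s0 k 0 v).
  move=> Hk; apply: data_eq => a i Ha; rewrite putE.
  by case: (a =P k) => [Ea|_] //; lia.
have [Hd3 Hs3 Hm3 Hc3] := @guess_ok s2 (Hdput _ _ 12 isT Hd') (@solved_put _ 12 _ isT isT Hs').
have [Hd5 Hs5 Hm5 Hc5] := @guess_ok s4 (Hdput _ _ 12 isT Hd3) (@solved_put _ 12 _ isT isT Hs3).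
have Fg s0 : sem guess_cmd s0 13 0 = s0 13 0.
  exact: sem_frame.
have E3 : s3 13 0 = t by rewrite /s3 Fg.
have E2 : s2 12 0 = w t by rewrite /s2 putE /= E13 Hw.
have E4 : s4 12 0 = f t.
  by have [_ _ /(_ _ Ht) [_ _ _ Hf3] _] := Hd3; rewrite /s4 putE /= E3 -Hf3.
have E5 : s5 13 0 = t by rewrite /s5 Fg /s4 putE.
have [Em3 Em5] : (forall v, covers s2 v -> covers s4 v) /\
    (forall v, covers s' v -> covers s2 v).
  by split=> v Hv; [exact: (@covers_put _ 12 _ _ isT (Hm3 v Hv)) | apply: covers_put].
rewrite -/s3 in Hc3; rewrite -/s5 in Hd5 Hs5 Hm5 Hc5.
have {}Hc3 v : v < scale L * scale L ->
    let c := table w u h f B L (w t) L (scale L + v) in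
    second_load c <= B -> covers s4 (maxn (first_load c) (w t)).
  by move=> Hv; rewrite -E2 => c0 Hl; apply: covers_put => //; apply: Hc3.
rewrite E4 in Hc5; clearbody s5.
split.
- by rewrite putE /= E5 addn1.
- exact: Hdput.
- exact: solved_put.
move=> i G v; rewrite ltnS leq_eqVlt => /predU1P[->|Hi] HG Hv /= Hl.
  case: HG Hl => -> Hl.
    by apply: covers_put => //; apply: Hm5; apply: Hc3.
  by apply: covers_put => //; apply: Hc5.
apply: covers_put => //; apply: Hm5; apply: Em3; apply: Em5; exact: (Hc' i G v).
Qed.

(** For each competitor, [table_approx] names a guess and a cell that the search has covered, so the
    recorded value is at least as good. One feasible assignment suffices to exclude the empty case
    of [solved]. *)
Lemma search_approx m s : data s -> m < L -> 1 < L ->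
  (exists y, feasible u h B L y) ->
  exists y, [/\ feasible u h B L y,
    sem search_cmd s 23 0 = sum_if y (expn 2) L &
    forall y', feasible u h B L y' ->
      m * objective w f L y <= m.+1 * objective w f L y'].
Proof.
move=> Hd Hm HL [y0 Hy0]; have [Hs Hc] := search_ok Hd.
have best y' : feasible u h B L y' -> exists v, covers (sem search_cmd s) v /\
    m * v <= m.+1 * objective w f L y'.
  move=> Hy'; have [G [v [[i Hi HG] Hv Hl Ho]]] := @table_approx w u h f B L m y' Hm HL Hy'.
  by exists (maxn (first_load (table w u h f B L G L (scale L + v))) G); split=> //; exact: (Hc i).
case: Hs => [E|[y [Hy1 Hy2 Hy3]]].
  by have [v [Hv _]] := best _ Hy0; rewrite /covers E in Hv.
exists y; split=> // y' /best [v [Hv Ho]]; apply: leq_trans Ho.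
by rewrite leq_mul2l; move: Hv Hy2; rewrite /covers; lia.
Qed.

End Search.

(** * Reading the instance and writing the schedule *)

Notation Item c :=
  (Arr 0 (Plus (Plus (Plus (Var 11) (Var 11)) (Plus (Var 11) (Var 11))) (Cst c))).

(** [Item c] reads entry [4 * i + c] for the item [i] in scalar 11: the input has a header of four
    entries, then four entries per job. *)
Definition load_cmd (ew eu eh ef : expr) : cmd :=
  SetV 11 (Cst 0) ;; SetV 14 (Cst 1) ;;
  For (Put 2 (Var 11) ew ;; Put 3 (Var 11) eu ;; Put 4 (Var 11) eh ;;
       Put 5 (Var 11) ef ;; Put 6 (Var 11) (Var 14) ;;
       SetV 14 (Plus (Var 14) (Var 14)) ;; SetV 11 (Plus (Var 11) (Cst 1))).

(** The expressions are evaluated while the arrays are being filled, so their meaning is assumed in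
    every environment with the same array 0. *)
Lemma load_ok ew eu eh ef (w u h f : nat -> nat) B L s :
  (forall s' i, s' 11 0 = i -> (forall j, s' 0 j = s 0 j) ->
    [/\ eval s' ew = w i, eval s' eu = u i, eval s' eh = h i & eval s' ef = f i]) ->
  s 1 0 = L -> s 0 0 = B -> data w u h f B L (sem (load_cmd ew eu eh ef) s).
Proof.
move=> He HL HB; rewrite /load_cmd 2!sem_seq !sem_put /=.
set s1 := put _ 14 0 _; set c := (_ ;; _); set s2 := sem _ s1.
have F0 j : s2 0 j = s 0 j by rewrite /s2 sem_frame.
pose I (t : nat) (s' : env) : Prop := [/\ s' 11 0 = t, s' 14 0 = 2 ^ t,
  forall i, i < t -> [/\ s' 2 i = w i, s' 3 i = u i, s' 4 i = h i & s' 5 i = f i] &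
  forall i, i < t -> s' 6 i = 2 ^ i].
suff [_ _ H1 H2] : I L s2 by split=> //; rewrite ?F0 // /s2 sem_frame.
apply: (@rep_ind 1 c L I) => //.
move=> t s' Ht F [E11 E14 I1 I2]; rewrite /c sem_seq sem_put.
have [V1 V2 V3 V4] := He s' t E11 (fun j => F 0 j isT).
rewrite [eval _ (Var 11)]/= E11 V1; set s3 := put s' 2 t _.
have [_ {}V2 _ _] := He s3 t E11 (fun j => F 0 j isT).
rewrite sem_seq sem_put [eval _ (Var 11)]/= V2 [s3 11 0]E11; set s4 := put s3 3 t _.
have [_ _ {}V3 _] := He s4 t E11 (fun j => F 0 j isT).
rewrite sem_seq sem_put [eval _ (Var 11)]/= V3 [s4 11 0]E11; set s5 := put s4 4 t _.
have [_ _ _ {}V4] := He s5 t E11 (fun j => F 0 j isT).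
rewrite sem_seq sem_put [eval _ (Var 11)]/= V4 [s5 11 0]E11; set s6 := put s5 5 t _.
have T11 : s6 11 0 = t by exact: E11.
have T14 : s6 14 0 = 2 ^ t by exact: E14.
have T6 i : s6 6 i = s' 6 i by [].
have T i : [/\ s6 2 i = if i == t then w t else s' 2 i,
    s6 3 i = if i == t then u t else s' 3 i, s6 4 i = if i == t then h t else s' 4 i
    & s6 5 i = if i == t then f t else s' 5 i] by [].
rewrite !semE /= !putE /= T11 T14.
split=> [||i|i]; rewrite !putE //=.
- by rewrite addn1.
- by rewrite expnS mul2n addnn.
- have [-> -> -> ->] := T i.
  by rewrite ltnS leq_eqVlt => /predU1P[->|Hi]; rewrite ?eqxx // (ltn_eqF Hi); apply: I1.
- by rewrite T6 ltnS leq_eqVlt => /predU1P[->|Hi]; rewrite ?eqxx // (ltn_eqF Hi); apply: I2.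
Qed.

(* Scalar 15 tells whether item [i] is on the second side. *)
Definition emit_cmd (ecloud : expr) : cmd :=
  SetV 11 (Minus (Var 11) (Cst 1)) ;;
  SetV 15 (Minus (Cst 1) (Minus (Arr 6 (Var 11)) (Var 23))) ;;
  If (Var 15) Skip (SetV 23 (Minus (Var 23) (Arr 6 (Var 11)))) ;;
  If ecloud
    (SetV 26 (Plus (Var 26) (Item 4)) ;;
     Put 10 (Plus (Plus (Var 11) (Var 11)) (Cst 3)) (Cst 0) ;;
     Put 10 (Plus (Plus (Var 11) (Var 11)) (Cst 4)) (Var 26) ;;
     SetV 27 (Plus (Var 27) (Minus (Var 26) (Var 27))))
    (Put 10 (Plus (Plus (Var 11) (Var 11)) (Cst 3)) (Cst 1) ;;
     Put 10 (Plus (Plus (Var 11) (Var 11)) (Cst 4)) (Plus (Item 6) (Item 5)) ;;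
     SetV 27 (Plus (Var 27) (Minus (Plus (Plus (Item 6) (Item 5)) (Item 7)) (Var 27)))).

(** Jobs are treated from last to first, because the mask is peeled from its highest bit. Scalar 26
    accumulates the completion times on the server, 27 the makespan. *)
Definition output_cmd (ecloud : expr) : cmd :=
  SetV 11 (Var 1) ;; SetV 26 (Cst 0) ;; SetV 27 (Cst 0) ;; For (emit_cmd ecloud) ;;
  Put 10 (Cst 0) (Cst 1) ;; Put 10 (Cst 1) (Cst 0) ;; Put 10 (Cst 2) (Var 27).

Section Output.

Variables (ps pc cin cout : nat -> nat) (L : nat) (y cl : nat -> bool).

(** For a server job [k] this is its completion time when the server runs without idle time in
    decreasing order of index. *)
Definition server_load (k : nat) : nat := \sum_(k <= i < L) (if cl i then 0 else ps i).

Definition cloud_delay (k : nat) : nat :=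
  \max_(k <= i < L) (if cl i then cin i + pc i + cout i else 0).

Lemma sum_if_pow2_bit (k : nat) :
  (1 - (2 ^ k - sum_if y (expn 2) k.+1)) = y k :> nat.
Proof.
have := sum_if_pow2_lt y k; have := expn_gt0 2 k.
by rewrite sum_ifS; case: (y k) => /=; lia.
Qed.

Lemma output_ok ecloud s :
  (forall s' i, s' 15 0 = y i :> nat -> (eval s' ecloud == 0) = ~~ cl i) ->
  s 1 0 = L -> (forall i, i < L -> s 6 i = 2 ^ i) -> s 23 0 = sum_if y (expn 2) L ->
  (forall i, [/\ s 0 (4 * i + 4) = ps i, s 0 (4 * i + 5) = pc i,
    s 0 (4 * i + 6) = cin i & s 0 (4 * i + 7) = cout i]) ->
  let out := sem (output_cmd ecloud) s 10 in
  [/\ out 0 = 1, out 1 = 0, out 2 = maxn (server_load 0) (cloud_delay 0) &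
    forall i, i < L -> out (2 * i + 3) = cl i :> nat /\
      out (2 * i + 4) = if cl i then cin i + pc i else server_load i].
Proof.
move=> He HL Hp Hm Hin; rewrite /output_cmd 4!sem_seq !sem_put /=.
set s1 := put _ 27 0 _; set c := emit_cmd _.
(* After [t] iterations the items from [L - t] on are written, and the mask has kept only the bits
   below [L - t]. *)
pose I (t : nat) (s' : env) : Prop :=
  [/\ s' 11 0 = L - t, s' 23 0 = sum_if y (expn 2) (L - t),
      s' 26 0 = server_load (L - t),
      s' 27 0 = maxn (server_load (L - t)) (cloud_delay (L - t)) &
      forall i, L - t <= i < L -> s' 10 (2 * i + 3) = cl i :> nat /\
        s' 10 (2 * i + 4) = if cl i then cin i + pc i else server_load i].
suff : I L (sem (For c) s1).
  rewrite /I subnn => -[_ _ _ E27 H]; rewrite !semE /=.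
  rewrite !putE /= E27; split=> // i Hi.
  have [H1 H2] := H i Hi; rewrite !putE /=.
  by do ![case: eqP => [|_]; first lia].
apply: (@rep_ind 1 c L I) => //.
  rewrite /I subn0 /server_load /cloud_delay !big_geq // /s1 !putE /= HL Hm.
  by split=> // i; lia.
move=> t s' Ht F [E11 E23 E26 E27 Hout].
have F6 i : s' 6 i = s 6 i by rewrite F.
have F0 i : s' 0 i = s 0 i by rewrite F.
set i0 := L - t.+1.
have Ei : L - t = i0.+1 by rewrite /i0; lia.
have Hi0 : i0 < L by rewrite /i0; lia.
rewrite Ei in E11 E23 E26 E27 Hout.
rewrite /c /emit_cmd sem_seq sem_put [eval _ (Cst 0)]/= [eval _ _]/= E11 subn1.
set s2 := put s' 11 0 _; rewrite sem_seq sem_put [eval _ (Cst 0)]/=.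
have -> : eval s2 (Minus (Cst 1) (Minus (Arr 6 (Var 11)) (Var 23))) = y i0.
  by rewrite /= /s2 !putE /= F6 Hp // E23 sum_if_pow2_bit.
set s3 := put s2 15 0 _; rewrite sem_seq.
set s4 := sem (If _ _ _) s3.
have E4 a i : s4 a i = if (a == 23) && (i == 0) then sum_if y (expn 2) i0 else s3 a i.
  have E3 : s3 23 0 = sum_if y (expn 2) i0 + (if y i0 then 2 ^ i0 else 0).
    by rewrite /s3 /s2 !putE /= E23 sum_ifS.
  have E3' : s3 6 (s3 11 0) = 2 ^ i0 by rewrite /s3 /s2 !putE /= F6 Hp.
  have E15 : s3 15 0 = y i0 by [].
  rewrite /s4 sem_if /= E15.
  move: E3; case: (y i0) => /= E3; rewrite ?sem_put ?putE /= ?E3 ?E3' ?addnK //.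
  by rewrite sem_skip; case: ifP => // /andP[/eqP-> /eqP->]; rewrite E3 addn0.
have F4 a i : a \notin [:: 11; 15; 23] -> s4 a i = s' a i.
  rewrite !inE !negb_or => /and3P[/negPf H1 /negPf H2 /negPf H3].
  by rewrite E4 H3 /= /s3 /s2 !putE H1 H2.
have T11 : s4 11 0 = i0 by rewrite E4.
have T15 : s4 15 0 = y i0 by rewrite E4.
have T23 : s4 23 0 = sum_if y (expn 2) i0 by rewrite E4.
have T26 : s4 26 0 = server_load i0.+1 by rewrite F4.
have T27 : s4 27 0 = maxn (server_load i0.+1) (cloud_delay i0.+1) by rewrite F4.
have Eidx : i0 + i0 + (i0 + i0) = 4 * i0 by lia.
have [V4 V5 V6 V7] : [/\ s4 0 (4 * i0 + 4) = ps i0, s4 0 (4 * i0 + 5) = pc i0,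
    s4 0 (4 * i0 + 6) = cin i0 & s4 0 (4 * i0 + 7) = cout i0].
  by rewrite !F4 // !F0.
have Sl : server_load i0 = (if cl i0 then 0 else ps i0) + server_load i0.+1.
  by rewrite /server_load big_ltn.
have Sd : cloud_delay i0 =
    maxn (if cl i0 then cin i0 + pc i0 + cout i0 else 0) (cloud_delay i0.+1).
  by rewrite /cloud_delay big_ltn.
have Hold i : i0 < i < L -> s4 10 (2 * i + 3) = cl i :> nat /\
    s4 10 (2 * i + 4) = if cl i then cin i + pc i else server_load i.
  by rewrite !F4 //; apply: Hout.
have Hsplit (P : nat -> Prop) : P i0 -> (forall i, i0 < i < L -> P i) ->
    forall i, i0 <= i < L -> P i.
  by move=> H1 H2 i /andP[]; rewrite leq_eqVlt => /predU1P[<-//|Hi] Hi'; apply: H2; rewrite Hi.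
rewrite sem_if (He _ _ T15) /I Sl Sd; move: s4 {E4 F4} T11 T15 T23 T26 T27 V4 V5 V6 V7 Hold => s4.
move=> T11 T15 T23 T26 T27 V4 V5 V6 V7 Hold.
have Ed : i0 + i0 = 2 * i0 by lia.
have N33 i : (2 * i + 3 == 2 * i0 + 3) = (i == i0) by lia.
have N34 i : (2 * i + 3 == 2 * i0 + 4) = false by lia.
have N43 i : (2 * i + 4 == 2 * i0 + 3) = false by lia.
have N44 i : (2 * i + 4 == 2 * i0 + 4) = (i == i0) by lia.
case Ecl: (cl i0); rewrite !semE /= !putE /= !T11 !Eidx !Ed ?V4 ?V5 ?V6 ?V7 ?T26 ?T27;
  split; rewrite ?putE //= ?T26 ?T27; try lia.
all: apply: Hsplit => [|i /andP[Hi Hi']]; rewrite !putE /= !(N33, N34, N43, N44).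
- by rewrite eqxx Ecl.
- by rewrite gtn_eqF //; apply: Hold; rewrite Hi.
- by rewrite eqxx Ecl Sl Ecl addnC.
- by rewrite gtn_eqF //; apply: Hold; rewrite Hi.
Qed.

End Output.

(** * Schedules of fully parallel instances *)

Lemma sum_option (T : finType) (P : pred (option T)) (F : option T -> nat) :
  \sum_(x | P x) F x =
  (if P None then F None else 0) + \sum_(x | P (Some x)) F (Some x).
Proof.
rewrite big_mkcond (bigD1 None) //=; congr (_ + _).
rewrite [RHS]big_mkcond (reindex_omap Some id) //=; last by case.
by apply: eq_big => // x; rewrite eqxx.
Qed.

(* Every time unit before [T] lies in at most one of the disjoint intervals [C i - p i, C i[. *)
Lemma disjoint_load (I : finType) (A : pred I) (C p : I -> nat) (T : nat) :
  (forall i, A i -> p i <= C i <= T) ->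
  (forall i j, i != j -> A i -> A j -> C i + p j <= C j \/ C j + p i <= C i) ->
  \sum_(i | A i) p i <= T.
Proof.
move=> Hb Hd.
have count_p i : A i -> p i = \sum_(t < T) (C i - p i <= t < C i).
  move=> /Hb /andP[H1 H2].
  rewrite -(big_mkord xpredT (fun t => nat_of_bool (C i - p i <= t < C i))).
  rewrite (@big_cat_nat _ _ _ (C i - p i)) //=; last by lia.
  rewrite (@big_cat_nat _ _ _ (C i) (C i - p i)) //=; last by lia.
  rewrite [X in X + (_ + _)]big1_seq; last by move=> t; rewrite mem_index_iota; lia.
  rewrite [X in _ + (_ + X)]big1_seq; last by move=> t; rewrite mem_index_iota; lia.
  rewrite (eq_big_nat _ _ (F2 := fun=> 1)); last by move=> t Ht; rewrite Ht.
  by rewrite sum_nat_const_nat; lia.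
rewrite (eq_bigr _ count_p) exchange_big /= -[leqRHS]card_ord -sum1_card.
apply: leq_sum => t _.
case: (pickP [pred i | A i && (C i - p i <= t < C i)]) => [i /andP[Ai Hi]|H0].
  rewrite (bigD1 i) //= Hi big1 // => j /andP[Aj Hj].
  by have := Hd _ _ Hj Aj Ai; lia.
by rewrite big1 // => i Ai; have /= := H0 i; rewrite Ai /= => ->.
Qed.

Section FullyParallel.

Variables (n : nat) (psf pcf cin cout : 'I_n -> nat).
Let I := fp_instance n psf pcf cin cout.
Implicit Types (S : schedule (job I)) (i j : 'I_n).

Definition inner i : job I := Some (Some i).

Lemma valid_ends S : valid I S -> ~~ on_cloud _ S (src I) /\ ~~ on_cloud _ S (snk I).
Proof. by case=> H _; split; apply/negP => /H. Qed.

Lemma valid_cost S : valid I S ->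
  cost I S = \sum_(i | on_cloud _ S (inner i)) pcf i.
Proof.
move=> /valid_ends [H1 H2]; rewrite /cost /= !sum_option /=.
by rewrite (negPf H1) (negPf H2).
Qed.

(** Source and sink are server jobs of length 0 at the two ends of the schedule, so they are
    disjoint from the other server jobs as soon as each of these fits between them. *)
Lemma valid_intro S : ~~ on_cloud _ S (src I) -> ~~ on_cloud _ S (snk I) ->
  ctime _ S (src I) = 0 ->
  (forall i, if on_cloud _ S (inner i)
     then cin i + pcf i <= ctime _ S (inner i) /\ ctime _ S (inner i) + cout i <= makespan I S
     else psf i <= ctime _ S (inner i) /\ ctime _ S (inner i) <= makespan I S) ->
  (forall i j, i < j -> ~~ on_cloud _ S (inner i) -> ~~ on_cloud _ S (inner j) ->
     ctime _ S (inner j) + psf i <= ctime _ S (inner i)) ->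
  valid I S.
Proof.
move=> H1 H2 H3 Hi Hij; split; [|split].
- by move=> [[i|]|] //=; rewrite ?(negPf H1) ?(negPf H2).
- have srv i : ~~ on_cloud _ S (inner i) ->
      psf i <= ctime _ S (inner i) /\ ctime _ S (inner i) <= makespan I S.
    by move=> /negPf Hc; have := Hi i; rewrite Hc.
  move=> [[i|]|] [[j|]|] //= Hne Ci Cj.
  + case: (ltngtP i j) => Eij; [right|left|]; [exact: Hij|exact: Hij|].
    by case/eqP: Hne; rewrite (val_inj Eij).
  + by left; rewrite addn0; have [] := srv i Ci.
  + by right; rewrite H3; have [] := srv i Ci.
  + by right; rewrite addn0; have [] := srv j Cj.
  + by right; rewrite H3.
  + by left; rewrite H3; have [] := srv j Cj.
  + by left; rewrite H3.
- move=> [[i|]|] [[j|]|] //= _.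
  + rewrite /ptime (negPf H2) /= addn0; have := Hi i.
    by rewrite /inner; case: (on_cloud _ S (Some (Some i))) => /= -[H H']; rewrite ?addn0.
  + rewrite /ptime H3 (negPf H1) /=; have := Hi j.
    by rewrite /inner; case: (on_cloud _ S (Some (Some j))) => /= -[H H'].
Qed.

(** Source and sink are on the server, so both edges of a cloud job cross sides. With [valid_server]
    this makes the two-sided objective a lower bound for the makespan. *)
Lemma valid_cloud S i : valid I S -> on_cloud _ S (inner i) ->
  cin i + pcf i + cout i <= makespan I S.
Proof.
move=> HS Hi; have [H1 H2] := valid_ends HS; case: HS => _ [_ He].
have := He (src I) (inner i) isT; have := He (inner i) (snk I) isT.
rewrite /ptime Hi (negPf H1) (negPf H2) /= addn0 /makespan /=; lia.
Qed.

Lemma valid_server S : valid I S ->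
  \sum_(i | ~~ on_cloud _ S (inner i)) psf i <= makespan I S.
Proof.
move=> HS; have [H1 H2] := valid_ends HS; case: HS => _ [Hd He].
apply: (@disjoint_load _ _ (fun i => ctime _ S (inner i))).
- move=> i Hi; have := He (src I) (inner i) isT; have := He (inner i) (snk I) isT.
  rewrite /ptime (negPf Hi) (negPf H1) (negPf H2) /= !addn0 /makespan /=; lia.
- move=> i j Hij Hi Hj; apply: (Hd (inner i) (inner j)) => //.
Qed.

End FullyParallel.

(** * Running a compiled program on the raw input *)

Lemma run_jz0 P pc m r l : nth IHalt P pc = IJz r l -> m r = 0 ->
  run P 1 (St pc m) = St l m.
Proof. by move=> Hi Hr; rewrite /run /= (step_jz _ Hi) Hr. Qed.

Lemma run_jzS P pc m r l : nth IHalt P pc = IJz r l -> m r != 0 ->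
  run P 1 (St pc m) = St pc.+1 m.
Proof. by move=> Hi /negPf Hr; rewrite /run /= (step_jz _ Hi) Hr. Qed.

Lemma run_jmp P pc m l : nth IHalt P pc = IJmp l -> run P 1 (St pc m) = St l m.
Proof. exact: step_jmp. Qed.

(** The input occupies the low registers that the compiled code works in. Straight-line code moves
    them away while none is free for a counter; register 0 is the moving pointer, register 1 the
    stride. *)
Fixpoint save_regs (k : nat) : seq instr :=
  if k is k'.+1 then save_regs k' ++ [:: IAdd 0 0 1; IStore 0 k'.+2] else [::].

Fixpoint load_regs (k : nat) : seq instr :=
  if k is k'.+1 then [:: ISub 0 0 1, ILoad k'.+2 0 & load_regs k'] else [::].

Lemma save_regs_ok k b m : k < 63 -> 64 <= b -> m 0 = b -> m 1 = 32 ->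
  let m' := foldl exec1 m (save_regs k) in
  [/\ m' 0 = b + 32 * k, m' 1 = 32,
      forall i, i < k -> m' (b + 32 * i.+1) = m i.+2 &
      forall x, 0 < x -> (forall i, i < k -> x != b + 32 * i.+1) -> m' x = m x].
Proof.
move=> Hk Hb H0 H1; elim: k Hk => [|k IH] Hk; first by split=> //=; rewrite muln0 addn0.
rewrite /= foldl_cat; have [E0 E1 Ei Ex] := IH (ltnW Hk).
move: (foldl exec1 m _) E0 E1 Ei Ex => m1 E0 E1 Ei Ex.
rewrite [foldl _ m1 _]/=; set m2 := upd m1 0 (m1 0 + m1 1).
have E20 : m2 0 = b + 32 * k.+1 by rewrite /m2 upd_same E0 E1; lia.
have F2 x : 0 < x -> m2 x = m1 x by move=> Hx; rewrite /m2 upd_neq //; lia.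
have Ek : m2 k.+2 = m k.+2.
  by rewrite F2 // Ex // => i Hi; lia.
rewrite E20 Ek; split.
- by rewrite upd_neq ?E20 //; lia.
- by rewrite upd_neq ?F2 //; lia.
- move=> i; rewrite ltnS leq_eqVlt => /predU1P[->|Hi]; first by rewrite upd_same.
  by rewrite upd_neq ?F2 ?Ei //; lia.
- move=> x Hx Hne; rewrite upd_neq ?F2 ?Ex //; last exact: Hne.
  by move=> i Hi; apply: Hne; lia.
Qed.

Lemma load_regs_ok k b m : k < 63 -> 64 <= b -> m 0 = b + 32 * k -> m 1 = 32 ->
  let m' := foldl exec1 m (load_regs k) in
  [/\ m' 0 = b, m' 1 = 32, forall i, i < k -> m' i.+2 = m (b + 32 * i) &
      forall x, k.+2 <= x -> m' x = m x].
Proof.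
move=> Hk Hb; elim: k Hk m => [|k IH] Hk m H0 H1.
  by rewrite muln0 addn0 in H0; split.
rewrite [load_regs _]/= [foldl _ _ _]/=.
set m1 := upd m 0 (m 0 - m 1); set m2 := upd m1 k.+2 _.
have E1 : m1 0 = b + 32 * k by rewrite /m1 upd_same H0 H1; lia.
have F1 x : 0 < x -> m1 x = m x by move=> Hx; rewrite /m1 upd_neq //; lia.
have F2 x : x != k.+2 -> m2 x = m1 x by move=> Hx; rewrite /m2 upd_neq.
have [||E20 E21 Ei Ex] := IH (ltnW Hk) m2; rewrite ?F2 ?E1 ?F1 //.
split=> // [i|x Hx]; last by rewrite Ex ?F2 ?F1 //; lia.
rewrite ltnS leq_eqVlt => /predU1P[->|Hi].
  by rewrite Ex // /m2 upd_same E1 F1 //; lia.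
by rewrite Ei // F2 ?F1 //; lia.
Qed.

Lemma straight_save_regs k : all straight (save_regs k).
Proof. by elim: k => //= k IH; rewrite all_cat IH. Qed.

Lemma straight_load_regs k : all straight (load_regs k).
Proof. by elim: k. Qed.

(** Registers 2 and 3 are the source and target pointers, 4 the count, 5 and 6 the strides, 7 the
    constant 1 and 8 a buffer. *)
Definition copy_loop (off : nat) : seq instr :=
  [:: IJz 4 (off + 7); ILoad 8 2; IStore 3 8; IAdd 2 2 5; IAdd 3 3 6; ISub 4 4 7;
      IJmp off].

Lemma copy_loop_ok P off c a b sa sb m : code_at P off (copy_loop off) ->
  m 2 = a -> m 3 = b -> m 4 = c -> m 5 = sa -> m 6 = sb -> m 7 = 1 -> 0 < sb ->
  8 < a -> 8 < b -> (forall i j, i < c -> j < c -> a + sa * i != b + sb * j) ->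
  exists m', [/\ run P (7 * c + 1) (St off m) = St (off + 7) m', m' 0 = m 0,
    forall i, i < c -> m' (b + sb * i) = m (a + sa * i) &
    forall x, 8 < x -> (forall i, i < c -> x != b + sb * i) -> m' x = m x].
Proof.
move=> Hat; elim: c a b m => [|c IH] a b m H2 H3 H4 H5 H6 H7 Hsb Ha Hb Hab.
  exists m; split=> //; have [Hz _] := code_at_cons Hat.
  by rewrite /run /= (step_jz _ Hz) H4.
have [Hz Hat1] := code_at_cons Hat.
have Hat5 : code_at P off.+1 [:: ILoad 8 2; IStore 3 8; IAdd 2 2 5; IAdd 3 3 6; ISub 4 4 7].
  by have [] := @code_at_cat P off.+1 [:: _; _; _; _; _] [:: IJmp off] Hat1.
have [_ /code_at_cons [Hj _]] := @code_at_cat P off.+1 [:: _; _; _; _; _] [:: IJmp off] Hat1.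
have := run_straight m (isT : all straight [:: ILoad 8 2; IStore 3 8; IAdd 2 2 5;
  IAdd 3 3 6; ISub 4 4 7]) Hat5.
set m1 := foldl _ _ _ => Hrun.
have E1 x : m1 x = if x == 4 then c else if x == 3 then b + sb else
    if x == 2 then a + sa else if x == b then m a else if x == 8 then m a else m x.
  have b3 : (3 == b) = false by lia.
  have b2 : (2 == b) = false by lia.
  have b4 : (4 == b) = false by lia.
  have b5 : (5 == b) = false by lia.
  have b6 : (6 == b) = false by lia.
  have b7 : (7 == b) = false by lia.
  have b8 : (8 == b) = false by lia.
  by rewrite /m1 /= !updE /= H2 H3 /= b2 b3 b4 b5 b6 b7 H4 H5 H6 H7 subn1.
have N x : 8 < x -> [/\ (x == 4) = false, (x == 3) = false, (x == 2) = false & (x == 8) = false].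
  by move=> Hx; split; lia.
have b5 : (5 == b) = false by lia.
have b6 : (6 == b) = false by lia.
have b7 : (7 == b) = false by lia.
have b0 : (0 == b) = false by lia.
have [||||||||||m' [Hrun' E0 Ei Ex]] := IH (a + sa) (b + sb) m1;
  try by (rewrite ?E1 /= ?b5 ?b6 ?b7 //; lia).
  by move=> i j Hi Hj'; have := Hab i.+1 j.+1 Hi Hj'; rewrite !mulnS; lia.
exists m'; split.
- have -> : 7 * c.+1 + 1 = 1 + (5 + (1 + (7 * c + 1))) by lia.
  rewrite runD (run_jzS Hz) ?H4 // runD.
  by rewrite [run P 5 _]Hrun runD (run_jmp _ Hj) Hrun'.
- by rewrite E0 E1 /= b0.
- case=> [|i] Hi.
    have [n4 n3 n2 n8] := N b Hb.
    by rewrite !muln0 !addn0 Ex ?E1 ?n4 ?n3 ?n2 ?eqxx // => i _; lia.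
  have Hsrc : 8 < a + sa * i.+1 by lia.
  have [n4 n3 n2 n8] := N _ Hsrc.
  have := Ei i Hi; rewrite E1 -!addnA -!mulnS n4 n3 n2 n8 => ->.
  by have := Hab i.+1 0 Hi isT; rewrite muln0 addn0 => /negPf ->.
- move=> x Hx Hne; have [n4 n3 n2 n8] := N _ Hx.
  rewrite Ex //; last by move=> i Hi; have := Hne i.+1 Hi; rewrite mulnS; lia.
  by rewrite E1 n4 n3 n2 n8; have := Hne 0 isT; rewrite muln0 addn0 => /negPf ->.
Qed.

(** Register 3 holds the divisor and 4 the remainder; the test value, remainder plus one minus
    divisor, is 0 exactly when the remainder is the smaller. The quotient is added to register 7. *)
Definition div_loop (off : nat) : seq instr :=
  [:: IAdd 8 4 6; ISub 8 8 3; IJz 8 (off + 6); ISub 4 4 3; IAdd 7 7 6; IJmp off].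

Lemma div_loop_ok P off p q m : code_at P off (div_loop off) -> 0 < p ->
  m 3 = p -> m 4 = q -> m 6 = 1 ->
  exists m', [/\ run P (6 * (q %/ p) + 3) (St off m) = St (off + 6) m',
    m' 7 = m 7 + q %/ p & forall x, x \notin [:: 4; 7; 8] -> m' x = m x].
Proof.
move=> Hat p0; move En : (q %/ p) => n.
elim: n q m En => [|n IH] q m Eq H3 H4 H6.
all: have Hat2 : code_at P off [:: IAdd 8 4 6; ISub 8 8 3]
  by have [] := @code_at_cat P off [:: _; _] [:: _; _; _; _] Hat.
all: have [_ /code_at_cons [Hz Hat3]] := @code_at_cat P off [:: _; _] [:: _; _; _; _] Hat.
all: have := run_straight m (isT : all straight [:: IAdd 8 4 6; ISub 8 8 3]) Hat2.
all: set m1 := foldl _ _ _ => Hrun.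
all: have E1 x : m1 x = if x == 8 then q + 1 - p else m x
  by rewrite /m1 /= !updE /= H3 H4 H6; case: (x == 8).
- have Hq : q < p by move/eqP: Eq; rewrite -leqn0 leqNgt divn_gt0 // -ltnNge.
  exists m1; split.
  + rewrite muln0 add0n -[3]/(2 + 1) runD [run P 2 _]Hrun (run_jz0 Hz) // E1 /=; lia.
  + by rewrite addn0 E1.
  + by move=> x; rewrite !inE !negb_or E1 => /and3P[_ _ /negPf ->].
have Hq : p <= q by rewrite -divn_gt0 // Eq.
have Hat4 : code_at P (off + 2).+1 [:: ISub 4 4 3; IAdd 7 7 6].
  by have [] := @code_at_cat P _ [:: _; _] [:: IJmp off] Hat3.
have [_ /code_at_cons [Hj _]] := @code_at_cat P _ [:: _; _] [:: IJmp off] Hat3.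
have := run_straight m1 (isT : all straight [:: ISub 4 4 3; IAdd 7 7 6]) Hat4.
set m2 := foldl _ _ _ => Hrun2.
have E2 x : m2 x = if x == 7 then m 7 + 1 else if x == 4 then q - p else m1 x.
  by rewrite /m2 /= !updE /= !E1 /= H3 H4 H6.
have [||||m' [Hrun' E7 Ex]] := IH (q - p) m2; try by rewrite ?E2 ?E1.
  have : (q - p + p) %/ p = n.+1 by rewrite subnK.
  by rewrite divnDr ?dvdnn // divnn p0 addn1 => -[].
exists m'; split.
- have -> : 6 * n.+1 + 3 = 2 + (1 + (2 + (1 + (6 * n + 3)))) by lia.
  rewrite runD [run P 2 _]Hrun runD (run_jzS Hz); last by rewrite E1 /=; lia.
  by rewrite runD [run P 2 _]Hrun2 runD (run_jmp _ Hj).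
- by rewrite E7 E2 /=; lia.
- move=> x Hx; rewrite Ex // E2 E1; move: Hx; rewrite !inE !negb_or.
  by case/and3P => /negPf -> /negPf -> /negPf ->.
Qed.

(** Seven doublings turn the input length in register 0 into the base of the arrays. Register 1 is
    stored first, so that it can hold the stride. *)
Definition save_code (K : nat) : seq instr :=
  nseq 7 (IAdd 0 0 0) ++ [:: IStore 0 1; IConst 1 32] ++ save_regs 62 ++
  [:: IConst 1 K; ISub 0 0 1].

Definition fetch (r : nat) : seq instr := [:: IAdd 2 2 1; ILoad r 2].

(** Registers 3, 4 and 5 receive [p], [q] and [n]; register 7 starts at [n + 2], and the division
    completes it to [L]. *)
Definition fetch_code : seq instr :=
  [:: IConst 1 0; IAdd 2 0 1; IConst 1 32] ++ fetch 3 ++ fetch 4 ++ fetch 5 ++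
  [:: IConst 6 1; IAdd 7 5 6; IAdd 7 7 6].

(** This stores [L] as cell 0 of array 1 and prepares the copy of the entries beyond register 63.
    The count [4 * n + 4] is the whole input length; the surplus copies are zeros. *)
Definition copy_in_code (K a : nat) : seq instr :=
  [:: IAdd 2 0 6; IStore 2 7; IAdd 4 5 6; IAdd 4 4 4; IAdd 4 4 4; IConst 2 a;
      IConst 1 K; IAdd 3 0 1; IConst 5 1; IConst 6 32; IConst 7 1].

Definition copy_out_code (K a : nat) : seq instr :=
  [:: IConst 1 96; IAdd 2 0 1; ILoad 5 2; IConst 6 1; IAdd 4 5 6; IAdd 4 4 4;
      IAdd 4 4 4; IConst 1 K; IAdd 2 0 1; IConst 3 a; IConst 5 32; IConst 6 1;
      IConst 7 1].

(** Register 0 serves as pointer and ends at the base plus 10, so the output is much longer than the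
    schedule; [decode] looks only at its beginning. *)
Definition load_code (K : nat) : seq instr :=
  [:: IConst 1 K; IAdd 0 0 1; IConst 1 32] ++ load_regs 62 ++
  [:: ISub 0 0 1; ILoad 1 0].

Lemma foldl_double k m : let m' := foldl exec1 m (nseq k (IAdd 0 0 0)) in
  m' 0 = 2 ^ k * m 0 /\ forall x, 0 < x -> m' x = m x.
Proof.
elim: k m => [|k IH] m; first by rewrite expn0 mul1n.
have [E F] := IH (upd m 0 (m 0 + m 0)); split=> [|x Hx]; rewrite /=.
  by rewrite E upd_same expnS; lia.
by rewrite F // upd_neq //; lia.
Qed.

Lemma save_code_ok m : 0 < m 0 ->
  let b := 128 * m 0 in
  let m' := foldl exec1 m (save_code (32 * 62)) in
  [/\ m' 0 = b, forall i, i < 63 -> m' (b + 32 * i) = m i.+1 &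
    forall x, 64 <= x -> (forall i, i < 63 -> x != b + 32 * i) -> m' x = m x].
Proof.
move=> H0 b; rewrite /save_code.
have := fun m2 => @save_regs_ok 62 b m2 isT; move: (save_regs 62) => code Hcode.
rewrite !foldl_cat; have [K EK] : {K | K = 32 * 62} by exists (32 * 62).
rewrite -EK.
have [E1 F1] := foldl_double 7 m; move: (foldl exec1 m _) E1 F1 => m1 E1 F1.
have {}E1 : m1 0 = b by rewrite E1.
rewrite [foldl exec1 m1 _]/=; set m2 := upd (upd _ _ _) 1 32.
have E20 : m2 0 = b by rewrite /m2 !updE /= E1 (_ : (0 == b) = false) //; lia.
have E2b : m2 b = m 1 by rewrite /m2 !updE E1 eqxx F1 // (_ : (b == 1) = false) //; lia.
have F2 x : 1 < x -> x != b -> m2 x = m x.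
  by move=> H1 /negPf H2; rewrite /m2 !updE E1 H2 F1 1?ltnW // (_ : (x == 1) = false) //; lia.
have Hb : 64 <= b by rewrite /b; lia.
have E21 : m2 1 = 32 by rewrite /m2 upd_same.
have [E30 E31 Ei Ex] := Hcode m2 Hb E20 E21.
move: (foldl exec1 m2 _) E30 E31 Ei Ex => m3 E30 E31 Ei Ex; rewrite /=.
have F x : 1 < x -> upd (upd m3 1 K) 0 (upd m3 1 K 0 - upd m3 1 K 1) x = m3 x.
  by move=> Hx; rewrite !upd_neq //; lia.
split.
- by rewrite !updE /= E30 EK; lia.
- case=> [|i] Hi; rewrite F ?muln0 ?addn0; try lia.
    by rewrite Ex ?E2b //; [lia|move=> i _; lia].
  by rewrite Ei // F2 //; lia.
- move=> x Hx Hne; rewrite F ?Ex ?F2 //; try lia.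
  + by have := Hne 0 isT; rewrite muln0 addn0.
  + by move=> i Hi; apply: Hne.
Qed.

Lemma fetch_ok r m : 2 < r < 64 -> 64 <= m 2 -> m 1 = 32 ->
  let m' := foldl exec1 m (fetch r) in
  [/\ m' 2 = m 2 + 32, m' r = m (m 2 + 32) &
    forall x, x != 2 -> x != r -> m' x = m x].
Proof.
move=> Hr H2 H1 m'.
have E x : m' x = if x == r then m (m 2 + 32) else if x == 2 then m 2 + 32 else m x.
  by rewrite /m' /= !updE /= H1 (_ : (m 2 + 32 == 2) = false) //; lia.
split; first by rewrite E (_ : (2 == r) = false) //; lia.
  by rewrite E eqxx.
move=> x /negPf H3 /negPf H4; by rewrite E H3 H4.
Qed.

Lemma fetch_code_ok m : 64 <= m 0 ->
  let m' := foldl exec1 m fetch_code in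
  [/\ m' 0 = m 0, m' 3 = m (m 0 + 32), m' 4 = m (m 0 + 64), m' 5 = m (m 0 + 96) &
    [/\ m' 6 = 1, m' 7 = m (m 0 + 96) + 2 & forall x, 7 < x -> m' x = m x]].
Proof.
move=> Hb; rewrite /fetch_code !foldl_cat [foldl exec1 m _]/=.
set m1 := upd _ 1 32.
have E12 : m1 2 = m 0 by rewrite /m1 /= !updE /= addn0.
have E11 : m1 1 = 32 by [].
have F1 x : x != 1 -> x != 2 -> m1 x = m x.
  by move=> H1 H2; rewrite /m1 !updE (negPf H1) (negPf H2).
have [||] := @fetch_ok 3 m1 isT; [by rewrite E12 | by [] |].
move: m1 (foldl exec1 m1 _) E12 E11 F1 => m1 m2 E12 E11 F1 E22 E23 F2.
have [||] := @fetch_ok 4 m2 isT; [by rewrite E22; lia | by rewrite F2 |].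
move: m2 (foldl exec1 m2 _) E22 E23 F2 => m2 m3 E22 E23 F2 E32 E34 F3.
have [||] := @fetch_ok 5 m3 isT; [by rewrite E32; lia | by rewrite F3 // F2 |].
move: m3 (foldl exec1 m3 _) E32 E34 F3 => m3 m4 E32 E34 F3 E42 E45 F4.
have E43 : m4 3 = m (m 0 + 32).
  by rewrite F4 // F3 // E23 E12 F1 //; lia.
have E44 : m4 4 = m (m 0 + 64).
  by rewrite F4 // E34 E22 E12 F2 ?F1 -?addnA //; lia.
have {}E45 : m4 5 = m (m 0 + 96).
  by rewrite E45 E32 E22 E12 F3 ?F2 ?F1 -?addnA //; lia.
have E x : m (m 0 + 96) + 2 = m4 5 + 1 + 1 by rewrite E45; lia.
have F x : x != 1 -> x != 2 -> x != 3 -> x != 4 -> x != 5 -> m4 x = m x.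
  by move=> *; rewrite F4 // F3 // F2 // F1.
rewrite /= !updE /= F // E43 E44 E45; split=> //; split=> //; first by lia.
by move=> x Hx; rewrite !updE F; do ?[case: eqP => ?]; lia.
Qed.

Lemma copy_in_code_ok K a m : 64 <= m 0 -> m 6 = 1 ->
  let m' := foldl exec1 m (copy_in_code K a) in
  [/\ m' 0 = m 0, m' 2 = a, m' 3 = m 0 + K, m' 4 = 4 * m 5 + 4 &
    [/\ m' 5 = 1, m' 6 = 32, m' 7 = 1, m' (m 0 + 1) = m 7 &
      forall x, 7 < x -> x != m 0 + 1 -> m' x = m x]].
Proof.
move=> Hb H6 m'.
have N k : k < 64 -> (k == m 0 + 1) = false by lia.
have E x : m' x = if x == 7 then 1 else if x == 6 then 32 else if x == 5 then 1 else
  if x == 3 then m 0 + K else if x == 1 then K else if x == 2 then a else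
  if x == 4 then 4 * m 5 + 4 else if x == m 0 + 1 then m 7 else m x.
  rewrite /m' /= !updE /= H6 !(N 0, N 1, N 2, N 3, N 4, N 5, N 6, N 7) //.
  have -> : m 5 + 1 + (m 5 + 1) + (m 5 + 1 + (m 5 + 1)) = 4 * m 5 + 4 by lia.
  by do 8?(case: (x =P _) => // _).
split; try by rewrite E ?(N 0).
split; try by rewrite E.
  by rewrite E eqxx; do 7 (case: eqP => ?; first lia).
by move=> x Hx /negPf Hne; rewrite E Hne; do 7 (case: eqP => ?; first lia).
Qed.

Lemma copy_out_code_ok K a m : 64 <= m 0 ->
  let m' := foldl exec1 m (copy_out_code K a) in
  [/\ m' 0 = m 0, m' 2 = m 0 + K, m' 3 = a, m' 4 = 4 * m (m 0 + 96) + 4 &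
    [/\ m' 5 = 32, m' 6 = 1, m' 7 = 1 & forall x, 7 < x -> m' x = m x]].
Proof.
move=> Hb m'.
have N k : k < 64 -> (m 0 + 96 == k) = false by lia.
have E x : m' x = if x == 7 then 1 else if x == 6 then 1 else if x == 5 then 32 else
  if x == 3 then a else if x == 2 then m 0 + K else if x == 1 then K else
  if x == 4 then 4 * m (m 0 + 96) + 4 else m x.
  rewrite /m' /copy_out_code -[_ :: _]/([:: IConst 1 96; IAdd 2 0 1; ILoad 5 2; IConst 6 1] ++
    [:: IAdd 4 5 6; IAdd 4 4 4; IAdd 4 4 4; IConst 1 K; IAdd 2 0 1; IConst 3 a;
      IConst 5 32; IConst 6 1; IConst 7 1]) foldl_cat.
  set m1 := foldl exec1 m _.
  have E1 z : m1 z = if z == 6 then 1 else if z == 5 then m (m 0 + 96) else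
      if z == 2 then m 0 + 96 else if z == 1 then 96 else m z.
    by rewrite /m1 /= !updE /= !N.
  move: m1 E1 => m1 E1; rewrite /= !updE /= !E1 /=.
  have e k : k + 1 + (k + 1) + (k + 1 + (k + 1)) = 4 * k + 4 by lia.
  by rewrite e; do 8?(case: (x =P _) => // _).
rewrite !E; split=> //; split=> //.
by move=> x Hx; rewrite E; do 7 (case: eqP => ?; first lia).
Qed.

Lemma load_code_ok b m : 64 <= b -> m 0 = b ->
  let m' := foldl exec1 m (load_code (32 * 63 + 10)) in
  [/\ m' 0 = b + 10, forall i, i < 63 -> m' i.+1 = m (b + 32 * i + 10) &
    forall x, 64 <= x -> m' x = m x].
Proof.
move=> Hb H0; rewrite /load_code !foldl_cat.
have [K EK] : {K | K = 32 * 63 + 10} by exists (32 * 63 + 10).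
rewrite -EK.
rewrite [foldl exec1 m _]/=; set m1 := upd (upd _ _ _) 1 32.
have E10 : m1 0 = b + 42 + 32 * 62 by rewrite /m1 !updE /= H0 EK; lia.
have F1 x : 1 < x -> m1 x = m x by move=> Hx; rewrite /m1 !upd_neq //; lia.
have Hb' : 64 <= b + 42 by lia.
have [E20 E21 Ei Ex] := @load_regs_ok 62 (b + 42) m1 isT Hb' E10 erefl.
move: (foldl exec1 m1 _) E20 E21 Ei Ex => m2 E20 E21 Ei Ex.
rewrite [foldl exec1 m2 _]/=; set m3 := upd m2 0 _.
have E30 : m3 0 = b + 10 by rewrite /m3 upd_same E20 E21; lia.
have F3 x : 0 < x -> m3 x = m2 x by move=> Hx; rewrite /m3 upd_neq //; lia.
split.
- by rewrite upd_neq.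
- case=> [|i] Hi.
    by rewrite upd_same E30 F3 ?Ex ?F1 ?muln0 ?addn0 //; lia.
  by rewrite upd_neq // F3 // Ei // F1; [congr m; lia | lia].
- by move=> x Hx; rewrite upd_neq ?F3 ?Ex ?F1 //; lia.
Qed.

(** * The complete program and its running time *)

Definition boot_code : seq instr := save_code (32 * 62) ++ fetch_code.
Definition div_off : nat := size boot_code.
Definition in_off : nat := div_off + 6 + size (copy_in_code (32 * 63) 64).
Definition main_off : nat := in_off + 7.
Definition out_off (c : cmd) : nat := main_off + size (ccmd 1 main_off c) +
  size (copy_out_code (32 * 63 + 10) 64).

Definition program (c : cmd) : seq instr :=
  boot_code ++ div_loop div_off ++ copy_in_code (32 * 63) 64 ++ copy_loop in_off ++
  ccmd 1 main_off c ++ copy_out_code (32 * 63 + 10) 64 ++ copy_loop (out_off c) ++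
  load_code (32 * 63 + 10) ++ [:: IHalt].

Definition start_env (inp : seq nat) (L : nat) : env :=
  fun k i => if k == 0 then nth 0 inp i else if (k == 1) && (i == 0) then L else 0.

Lemma boot_ok P inp : size inp = 4 * nth 0 inp 3 + 4 -> 0 < nth 0 inp 1 ->
  code_at P 0 boot_code -> code_at P div_off (div_loop div_off) ->
  code_at P (div_off + 6) (copy_in_code (32 * 63) 64) ->
  code_at P in_off (copy_loop in_off) ->
  let r := nth 0 inp 2 %/ nth 0 inp 1 in
  exists m, [/\ run P (size boot_code + (6 * r + 3) + size (copy_in_code (32 * 63) 64) +
      (7 * size inp + 1)) (init inp) = St main_off m &
    represents (128 * size inp) (start_env inp (nth 0 inp 3 + 2 + r)) m].
Proof.
move=> Hsz Hp Hat1 Hat2 Hat3 Hat4 r.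
set b := 128 * size inp; set n := nth 0 inp 3.
set m0 := Defs.mem (init inp).
have Hb : 64 + size inp < b by rewrite /b; lia.
have E0 : m0 0 = size inp by [].
have H00 : 0 < m0 0 by rewrite E0; lia.
have [E10 E1i F1] := save_code_ok H00; rewrite E0 -/b in E10 E1i F1.
have Hs1 : all straight boot_code.
  rewrite /boot_code /save_code.
  by move: (save_regs 62) (straight_save_regs 62) => code Hc; rewrite !all_cat Hc.
have := run_straight m0 Hs1 Hat1; rewrite /boot_code foldl_cat -/boot_code.
move: (foldl exec1 m0 _) E10 E1i F1 => m1 E10 E1i F1.
have Hm1 : 64 <= m1 0 by rewrite E10; lia.
have [E20 E23 E24 E25 [E26 E27 F2]] := fetch_code_ok Hm1.
move: (foldl exec1 m1 _) E20 E23 E24 E25 E26 E27 F2 => m2 E20 E23 E24 E25 E26 E27 F2.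
rewrite E10 in E20 E23 E24 E25 E27.
have {}E23 : m2 3 = nth 0 inp 1 by rewrite E23 -[32]muln1 E1i.
have {}E24 : m2 4 = nth 0 inp 2 by rewrite E24 -[64]/(32 * 2) E1i.
have {}E25 : m2 5 = n by rewrite E25 -[96]/(32 * 3) E1i.
have {}E27 : m2 7 = n + 2 by rewrite E27 -[96]/(32 * 3) E1i.
rewrite add0n => Hrun1.
have [m3 [Hrun2 E37 F3]] := div_loop_ok Hat2 Hp E23 E24 E26.
rewrite -/r E27 in Hrun2 E37.
have Hm3 : 64 <= m3 0 by rewrite F3 // E20; lia.
have E36 : m3 6 = 1 by rewrite F3.
have := run_straight m3 (isT : all straight (copy_in_code (32 * 63) 64)) Hat3.
have [E40 E42 E43 E44 [E45 E46 E47 E4b F4]] := copy_in_code_ok (32 * 63) 64 Hm3 E36.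
move: (foldl exec1 m3 _) E40 E42 E43 E44 E45 E46 E47 E4b F4
  => m4 E40 E42 E43 E44 E45 E46 E47 E4b F4 Hrun3.
rewrite F3 // E20 in E40 E43 E4b F4.
have {}E44 : m4 4 = size inp by rewrite E44 F3 // E25 Hsz.
have F x : 64 <= x -> (forall i, i < 63 -> x != b + 32 * i) -> x != b + 1 ->
    m4 x = nth 0 inp x.-1.
  move=> H1 H2 H3; rewrite F4 //; last by lia.
  rewrite F3; last by rewrite !inE; lia.
  rewrite F2; last by lia.
  by rewrite F1 // /m0 /init; case: x H1 {H2 H3}.
have [|||m5 [Hrun4 E50 E5i F5]] := copy_loop_ok Hat4 E42 E43 E44 E45 E46 E47 isT.
- by [].
- by lia.
- by move=> i j Hi Hj; move: (32 * 63) => K; lia.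
exists m5; split.
  move: (6 * r + 3) (7 * _ + 1) Hrun2 Hrun4 => t2 t4 Hrun2 Hrun4.
  by rewrite !runD -[init inp]/(St 0 m0) Hrun1 Hrun2 Hrun3 Hrun4.
split; first by rewrite E50.
move=> k i Hk; rewrite /start_env.
have e63 : 32 * 63 = 2016 by [].
(* The cells fall into groups: input entries from 63 on come from the copy loop, the loop bound and
   the first 63 entries from the preceding code, and the rest still holds the zeros beyond the
   input. *)
case: (boolP ((k == 0) && (63 <= i < 63 + size inp))) => [/andP[/eqP-> Hi]|Hni].
  rewrite addn0 eqxx.
  have -> : b + 32 * i = b + 32 * 63 + 32 * (i - 63) by rewrite -addnA -mulnDr subnKC //; lia.
  rewrite E5i; last by lia.
  rewrite F; first by congr nth; lia.
  + by lia.
  + by move=> j Hj; lia.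
  + by lia.
rewrite F5; first last.
- by move=> j Hj; move: Hni; rewrite e63; lia.
- by lia.
case: (boolP ((k == 1) && (i == 0))) => [/andP[/eqP-> /eqP->]|Hk1].
  by rewrite muln0 addn0 E4b E37.
case: (boolP ((k == 0) && (i < 63))) => [/andP[/eqP-> Hi]|Hk0].
  rewrite addn0 F4; [|by lia|by lia].
  rewrite F3; last by rewrite !inE; lia.
  rewrite F2; last by lia.
  by rewrite E1i.
rewrite F; last by lia.
- rewrite nth_default; last by lia.
  by case: ifP => // H0; rewrite nth_default //; lia.
- by lia.
- by move=> j Hj; lia.
Qed.

Lemma run_halted P t s : halted P s -> run P t s = s.
Proof.
rewrite /halted /run => H; elim: t => //= t ->.
by rewrite /step; case: nth H.
Qed.

Lemma leq_size_bitsize inp : size inp <= bitsize inp.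
Proof.
rewrite /bitsize -sum1_size; exact: leq_sum.
Qed.

Lemma finish_ok P c inp L m : size inp = 4 * nth 0 inp 3 + 4 ->
  0 \notin mods c -> let b := 128 * size inp in
  let s := sem c (start_env inp L) in
  let off := main_off + size (ccmd 1 main_off c) in
  represents b s m -> code_at P off (copy_out_code (32 * 63 + 10) 64) ->
  code_at P (out_off c) (copy_loop (out_off c)) ->
  code_at P (out_off c + 7) (load_code (32 * 63 + 10)) ->
  exists m', run P (size (copy_out_code (32 * 63 + 10) 64) + (7 * size inp + 1) +
      size (load_code (32 * 63 + 10))) (St off m) =
    St (out_off c + 7 + size (load_code (32 * 63 + 10))) m' /\
    forall i pc, i < 62 + size inp -> nth 0 (output (St pc m')) i = s 10 i.
Proof.
move=> Hsz Hc b s off [H0 Hr] Hat1 Hat2 Hat3.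
have Hb : 64 + size inp < b by rewrite /b; lia.
have Hm : 64 <= m 0 by rewrite H0; lia.
have := run_straight m (isT : all straight (copy_out_code (32 * 63 + 10) 64)) Hat1.
have [E10 E12 E13 E14 [E15 E16 E17 F1]] := copy_out_code_ok (32 * 63 + 10) 64 Hm.
move: (foldl exec1 m _) E10 E12 E13 E14 E15 E16 E17 F1
  => m1 E10 E12 E13 E14 E15 E16 E17 F1 Hrun1.
rewrite H0 in E10 E12 E14.
have {}E14 : m1 4 = size inp.
  have := Hr 0 3 isT; rewrite addn0 -[32 * 3]/96 E14 => ->.
  by rewrite /s sem_frame.
have e63 : 32 * 63 = 2016 by [].
have [|||m2 [Hrun2 E20 E2i F2]] := copy_loop_ok Hat2 E12 E13 E14 E15 E16 E17 isT.
- by lia.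
- by [].
- by move=> i j Hi Hj; lia.
have Hm2 : m2 0 = b by rewrite E20.
have Hs : all straight (load_code (32 * 63 + 10)).
  rewrite /load_code.
  by move: (load_regs 62) (straight_load_regs 62) => code Hcode; rewrite !all_cat Hcode.
have := run_straight m2 Hs Hat3.
have Hb' : 64 <= b by lia.
have [E30 E3i F3] := load_code_ok Hb' Hm2.
move: (foldl exec1 m2 _) E30 E3i F3 => m3 E30 E3i F3 Hrun3.
exists m3; split.
  move: (7 * _ + 1) Hrun2 => t2 Hrun2.
  by rewrite !runD Hrun1 Hrun2 Hrun3.
move=> i pc Hi; rewrite /output [Defs.mem _]/= nth_mkseq; last by rewrite E30; lia.
case: (ltnP i 63) => Hi63.
  rewrite E3i // F2; [|by lia|by move=> j Hj; lia].
  by rewrite F1 ?Hr //; lia.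
rewrite F3; last by lia.
have -> : i.+1 = 64 + 1 * (i - 63) by lia.
rewrite E2i; last by lia.
rewrite F1; last by lia.
by rewrite -Hr //; congr m; lia.
Qed.

Lemma size_div_loop off : size (div_loop off) = 6. Proof. by []. Qed.

Lemma size_copy_loop off : size (copy_loop off) = 7. Proof. by []. Qed.

Lemma program_ok c : cwf 1 c -> 1 \notin mods c -> 0 \notin mods c ->
  exists a k, forall inp, size inp = 4 * nth 0 inp 3 + 4 -> 0 < nth 0 inp 1 ->
    let r := nth 0 inp 2 %/ nth 0 inp 1 in
    let fin := run (program c) (a * (bitsize inp + r + 1) ^ k) (init inp) in
    halted (program c) fin /\
    forall i, i < 62 + size inp ->
      nth 0 (output fin) i = sem c (start_env inp (nth 0 inp 3 + 2 + r)) 10 i.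
Proof.
move=> Hw Hm1 Hm0; set P := program c.
have [a [k Htb]] := tb_poly c.
pose K := size boot_code + 3 + size (copy_in_code (32 * 63) 64) +
  size (copy_out_code (32 * 63 + 10) 64) + size (load_code (32 * 63 + 10)) + 2.
exists (a + K + 20), k.+1 => inp Hsz Hp r fin.
have Hat : code_at P 0 P by [].
have [Hat1] := code_at_cat Hat; rewrite add0n -/div_off => Hat'.
have [Hat2] := code_at_cat Hat'; rewrite size_div_loop => {}Hat'.
have [Hat3] := code_at_cat Hat'; rewrite -/in_off => {}Hat'.
have [Hat4] := code_at_cat Hat'; rewrite size_copy_loop -/main_off => {}Hat'.
have [Hat5 {}Hat'] := code_at_cat Hat'.
have [Hat6] := code_at_cat Hat'; rewrite -/(out_off c) => {}Hat'.
have [Hat7] := code_at_cat Hat'; rewrite size_copy_loop => {}Hat'.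
have [Hat8 /code_at_cons [Hhalt _]] := code_at_cat Hat'.
have [m1 [Hrun1 Hrep1]] := boot_ok Hsz Hp Hat1 Hat2 Hat3 Hat4.
rewrite -/r in Hrun1 Hrep1.
set L := nth 0 inp 3 + 2 + r in Hrep1 *.
have Hb : 64 <= 128 * size inp by lia.
have [t [m2 [Ht Hrun2 Hrep2 _]]] := ccmd_ok Hb (isT : 0 < 1 < 32) Hrep1 Hw Hm1 Hat5.
have [m3 [Hrun3 Hout]] := finish_ok Hsz Hm0 Hrep2 Hat6 Hat7 Hat8.
set T1 := size boot_code + _ + _ + _ in Hrun1.
set T3 := size (copy_out_code _ _) + _ + _ in Hrun3.
have HL : start_env inp L 1 0 = L by [].
rewrite HL in Ht.
set X := bitsize inp + r + 1.
(* The bit size is at least the number [4 * n + 4] of input entries, which bounds [L] by the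
   quantity allowed in the running time. *)
have HLX : L.+1 <= X by have := leq_size_bitsize inp; rewrite /L /X; lia.
have HX : size inp + r + 1 <= X by have := leq_size_bitsize inp; rewrite /X; lia.
have HT : T1 + (t + T3) <= (a + K + 20) * X ^ k.+1.
  have H1 : t <= a * X ^ k.+1.
    apply: leq_trans Ht (leq_trans (Htb L) _).
    rewrite leq_mul2l; apply/orP; right; apply: (@leq_trans (X ^ k)).
      by move: (k) => [|k'] //; rewrite leq_exp2r.
    by rewrite leq_pexp2l //; lia.
  have H2 : X <= X ^ k.+1 by rewrite expnS leq_pmulr // expn_gt0; lia.
  have H3 : T1 + T3 <= K + 20 * X.
    rewrite /T1 /T3 /K; move: (size _) (size _) (size (copy_out_code _ _)) (size (load_code _)) HX.
    by move=> *; lia.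
  have H4 : K <= K * X ^ k.+1 by rewrite leq_pmulr // expn_gt0; lia.
  have H5 : 20 * X <= 20 * X ^ k.+1 by rewrite leq_mul2l.
  by rewrite !mulnDl; lia.
(* The machine halts after [T1 + (t + T3)] steps, and the remaining steps leave the state
   unchanged. *)
have Hfin : fin = St (out_off c + 7 + size (load_code (32 * 63 + 10))) m3.
  rewrite /fin -(subnKC HT) -/X runD.
  have -> : run P (T1 + (t + T3)) (init inp) =
      St (out_off c + 7 + size (load_code (32 * 63 + 10))) m3.
    by move: (T1) (T3) Hrun1 Hrun3 => t1 t3 Hrun1 Hrun3; rewrite !runD Hrun1 Hrun2 Hrun3.
  by apply: run_halted; rewrite /halted Hhalt.
rewrite Hfin; split; first by rewrite /halted Hhalt.
by move=> i Hi; apply: Hout.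
Qed.

(** * The two approximation schemes *)

(** Extension by zero agrees with what the program reads past the input; the padding jobs have no
    load and no delay. *)
Definition ext n (g : 'I_n -> nat) (i : nat) : nat := if insub i is Some j then g j else 0.

Lemma ext_ord n (g : 'I_n -> nat) (i : 'I_n) : ext g i = g i.
Proof. by rewrite /ext valK. Qed.

Lemma ext_out n (g : 'I_n -> nat) i : n <= i -> ext g i = 0.
Proof. by move=> H; rewrite /ext insubN // -leqNgt. Qed.

Lemma nth_map_enum n (g : 'I_n -> nat) i : nth 0 (map g (enum 'I_n)) i = ext g i.
Proof.
case: (ltnP i n) => Hi; last by rewrite ext_out // nth_default // size_map size_enum_ord.
rewrite (nth_map (Ordinal Hi)) ?size_enum_ord // -[i in RHS]/(val (Ordinal Hi)) ext_ord.
by congr g; apply: val_inj; rewrite /= nth_enum_ord.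
Qed.

Lemma nth_flatten4 (T : Type) (a b c d : T -> nat) (s : seq T) i :
  let l := flatten [seq [:: a t; b t; c t; d t] | t <- s] in
  [/\ nth 0 l (4 * i) = nth 0 (map a s) i, nth 0 l (4 * i + 1) = nth 0 (map b s) i,
      nth 0 l (4 * i + 2) = nth 0 (map c s) i & nth 0 l (4 * i + 3) = nth 0 (map d s) i].
Proof.
elim: s i => [|x s IH] i l; first by rewrite !nth_nil.
by case: i => [|i]; rewrite /l ?mulnS //=; apply: IH.
Qed.

Lemma size_enc n (psf pcf cin cout : 'I_n -> nat) x p q :
  size ([:: x; p; q] ++ enc_fp n psf pcf cin cout) = 4 * n + 4.
Proof.
rewrite /= size_flatten /shape -map_comp sumnE big_map big_enum /= sum_nat_const.
by rewrite card_ord; lia.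
Qed.

Lemma nth_enc n (psf pcf cin cout : 'I_n -> nat) x p q i :
  let inp := [:: x; p; q] ++ enc_fp n psf pcf cin cout in
  [/\ nth 0 inp (4 * i + 4) = ext psf i, nth 0 inp (4 * i + 5) = ext pcf i,
      nth 0 inp (4 * i + 6) = ext cin i & nth 0 inp (4 * i + 7) = ext cout i].
Proof.
have := nth_flatten4 psf pcf cin cout (enum 'I_n) i; rewrite !nth_map_enum.
by rewrite !addnS !addn0.
Qed.

Lemma sum_if_ext n (g : 'I_n -> nat) y L : n <= L ->
  sum_if y (ext g) L = \sum_(i < n | y i) g i.
Proof.
move=> HL; rewrite /sum_if -(big_mkord xpredT (fun i => if y i then ext g i else 0)).
rewrite (@big_cat_nat _ _ _ n) //= [X in _ + X]big1_seq ?addn0; last first.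
  move=> i /andP[_]; rewrite mem_index_iota => /andP[Hi _].
  by rewrite ext_out // if_same.
by rewrite big_mkord [RHS]big_mkcond; apply: eq_bigr => i _; rewrite ext_ord.
Qed.

Lemma server_load0 ps cl L : server_load ps L cl 0 = sum_if (negb \o cl) ps L.
Proof. by rewrite /server_load big_mkord; apply: eq_bigr => i _ /=; case: (cl i). Qed.

Lemma server_load_cat ps cl L i j : i <= j <= L ->
  server_load ps L cl i = \sum_(i <= k < j) (if cl k then 0 else ps k) + server_load ps L cl j.
Proof. by case/andP=> H1 H2; rewrite /server_load (@big_cat_nat _ _ _ j). Qed.

Lemma decode_ok n (psf pcf cin cout : 'I_n -> nat) (cl : nat -> bool) L out :
  let I := fp_instance n psf pcf cin cout in
  n <= L -> nth 0 out 0 = 1 -> nth 0 out 1 = 0 ->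
  nth 0 out 2 = maxn (server_load (ext psf) L cl 0)
    (cloud_delay (ext pcf) (ext cin) (ext cout) L cl 0) ->
  (forall i, i < n -> nth 0 out (2 * i + 3) = cl i :> nat /\ nth 0 out (2 * i + 4) =
     if cl i then ext cin i + ext pcf i else server_load (ext psf) L cl i) ->
  exists S, [/\ decode n out = Some S, valid I S,
    makespan I S = nth 0 out 2 & cost I S = sum_if cl (ext pcf) L].
Proof.
move=> I HL E0 E1 E2 Eo; rewrite /decode E0 /=; set S := Schedule _ _ _.
have ECl (i : 'I_n) : on_cloud _ S (inner psf pcf cin cout i) = cl i.
  by have [E _] := Eo i (ltn_ord i); rewrite /= addnC E; case: (cl i).
have ECt (i : 'I_n) : ctime _ S (inner psf pcf cin cout i) =
    if cl i then cin i + pcf i else server_load (ext psf) L cl i.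
  by have [_] := Eo i (ltn_ord i); rewrite !ext_ord /= addnC.
have ltL (i : 'I_n) : i < L by apply: leq_trans HL.
have Hms : makespan I S = nth 0 out 2 by [].
have HV : valid I S.
  apply: valid_intro => // [i|i j Hij].
    rewrite ECl ECt Hms E2; case Ec: (cl i).
      split=> //; rewrite leq_max; apply/orP; right.
      have := @leq_bigmax_seq _ (index_iota 0 L) xpredT
        (fun k => if cl k then ext cin k + ext pcf k + ext cout k else 0) i.
      by rewrite mem_index_iota /= ltL => /(_ isT isT); rewrite Ec !ext_ord.
    split; first by rewrite /server_load big_ltn // Ec ext_ord leq_addr.
    rewrite leq_max; apply/orP; left; rewrite (@server_load_cat _ _ _ 0 i) ?leq_addl //.
    by rewrite (ltnW (ltL i)).
  rewrite !ECl !ECt => /negPf Ci /negPf Cj; rewrite Ci Cj.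
  rewrite (@server_load_cat _ _ _ i j); last by rewrite (ltnW Hij) (ltnW (ltL j)).
  by rewrite big_ltn // Ci ext_ord; lia.
exists S; split=> //; rewrite (valid_cost HV) (sum_if_ext _ _ HL).
by apply: eq_bigl => i; rewrite ECl.
Qed.

Definition main (ew eu eh ef ecloud : expr) : cmd :=
  load_cmd ew eu eh ef ;; search_cmd ;; output_cmd ecloud.

(** [cl] translates sides into machines: it tells whether an item is on the cloud, given whether it
    is on the second side. *)
Lemma main_ok ew eu eh ef ecloud (w u h f ps pc cin cout : nat -> nat)
    (cl : bool -> bool) L m s :
  (forall s' i, s' 11 0 = i -> (forall j, s' 0 j = s 0 j) ->
    [/\ eval s' ew = w i, eval s' eu = u i, eval s' eh = h i & eval s' ef = f i]) ->
  (forall s' (b : bool), s' 15 0 = b :> nat -> (eval s' ecloud == 0) = ~~ cl b) ->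
  (forall i, [/\ s 0 (4 * i + 4) = ps i, s 0 (4 * i + 5) = pc i,
    s 0 (4 * i + 6) = cin i & s 0 (4 * i + 7) = cout i]) ->
  s 1 0 = L -> m < L -> 1 < L ->
  (exists y, feasible u h (s 0 0) L y) ->
  exists y, [/\ feasible u h (s 0 0) L y,
    forall y', feasible u h (s 0 0) L y' -> m * objective w f L y <= m.+1 * objective w f L y' &
    let out := sem (main ew eu eh ef ecloud) s 10 in
    [/\ out 0 = 1, out 1 = 0,
      out 2 = maxn (server_load ps L (cl \o y) 0) (cloud_delay pc cin cout L (cl \o y) 0) &
      forall i, i < L -> out (2 * i + 3) = cl (y i) :> nat /\
        out (2 * i + 4) = if cl (y i) then cin i + pc i else server_load ps L (cl \o y) i]].
Proof.
move=> He Hcl Hin HL Hm HL1 Hfeas.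
have Hd := load_ok He HL erefl.
have [y [Hy Hbm Hopt]] := search_approx Hd Hm HL1 Hfeas.
exists y; split=> //; rewrite /main 2!sem_seq.
set s1 := sem (load_cmd _ _ _ _) s; set s2 := sem search_cmd s1.
have [HL2 _ _ Hp2] : data w u h f (s 0 0) L s2 by apply: data_frame Hd.
apply: (@output_ok ps pc cin cout L y (cl \o y) ecloud s2) => // [s' i|i].
  exact: Hcl.
have F j : s2 0 j = s 0 j by rewrite /s2 sem_frame // /s1 sem_frame.
by rewrite !F.
Qed.

(** With [m = q %/ p + 1], the inequality [q < m * p] gives [1 / m < p / q]. *)
Lemma approx_ratio p q A O : 0 < p ->
  (q %/ p).+1 * A <= (q %/ p).+2 * O -> A * q <= (q + p) * O.
Proof.
move=> p0; have := ltn_ceil q p0; move: (q %/ p).+1 => m Hq H.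
have m0 : 0 < m by case: m Hq {H}; rewrite ?mul0n.
rewrite -(leq_pmul2l m0); rewrite mulSn in H.
have H1 : q * (m * A) <= q * (O + m * O) by rewrite leq_mul2l H orbT.
have H2 : q * O <= m * p * O by rewrite leq_mul2r ltnW // orbT.
by rewrite mulnDr in H1; rewrite mulnDl mulnDr; nia.
Qed.

Definition cost_main : cmd :=
  main (Item 5) (Item 4) (Minus (Plus (Plus (Item 6) (Item 5)) (Item 7)) (Arr 0 (Cst 0)))
    (Cst 0) (Minus (Cst 1) (Var 15)).

Definition makespan_main : cmd :=
  main (Item 4) (Item 5) (Cst 0) (Plus (Plus (Item 6) (Item 5)) (Item 7)) (Var 15).

Lemma eval_item s' s (g : nat -> nat) i c : s' 11 0 = i -> (forall j, s' 0 j = s j) ->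
  s (4 * i + c) = g i -> eval s' (Item c) = g i.
Proof.
by move=> E F <-; rewrite /= E F; congr s; lia.
Qed.

Section Final.

Variables (n : nat) (psf pcf cin cout : 'I_n -> nat) (x p q : nat).
Hypothesis (p_gt0 : 0 < p).
Let I := fp_instance n psf pcf cin cout.
Let inp := [:: x; p; q] ++ enc_fp n psf pcf cin cout.
Let L := n + 2 + q %/ p.
Let s := start_env inp L.
Let delay i := ext cin i + ext pcf i + ext cout i.

Lemma start_item i : [/\ s 0 (4 * i + 4) = ext psf i, s 0 (4 * i + 5) = ext pcf i,
    s 0 (4 * i + 6) = ext cin i & s 0 (4 * i + 7) = ext cout i].
Proof. exact: nth_enc. Qed.

Lemma eval_items s' i : s' 11 0 = i -> (forall j, s' 0 j = s 0 j) ->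
  [/\ eval s' (Item 4) = ext psf i, eval s' (Item 5) = ext pcf i,
    eval s' (Plus (Plus (Item 6) (Item 5)) (Item 7)) = delay i & s' 0 0 = x].
Proof.
move=> E F; have [E4 E5 E6 E7] := start_item i.
rewrite [eval s' (Plus _ _)]/= -/(eval s' (Item 6)) -/(eval s' (Item 5)) -/(eval s' (Item 7)).
by rewrite (eval_item E F E4) (eval_item E F E5) (eval_item E F E6) (eval_item E F E7) F.
Qed.

Definition cloud_pred (S : schedule (job I)) (k : nat) : bool :=
  if insub k is Some i then on_cloud _ S (inner psf pcf cin cout i) else false.

Lemma cloud_pred_ord S (i : 'I_n) : cloud_pred S i = on_cloud _ S (inner psf pcf cin cout i).
Proof. by rewrite /cloud_pred valK. Qed.

Lemma sum_if_cloud S : valid I S -> sum_if (cloud_pred S) (ext pcf) L = cost I S.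
Proof.
move=> HS; rewrite sum_if_ext; last by rewrite /L -addnA leq_addr.
by rewrite (valid_cost HS); apply: eq_bigl => i; rewrite cloud_pred_ord.
Qed.

Lemma sum_if_server S : valid I S ->
  sum_if (negb \o cloud_pred S) (ext psf) L <= makespan I S.
Proof.
move=> HS; rewrite sum_if_ext; last by rewrite /L -addnA leq_addr.
apply: leq_trans (valid_server HS); rewrite (eq_bigl (fun i : 'I_n =>
  ~~ on_cloud _ S (inner psf pcf cin cout i))) // => i.
by rewrite /= cloud_pred_ord.
Qed.

Lemma cloud_pred_delay S k : valid I S -> cloud_pred S k -> delay k <= makespan I S.
Proof.
move=> HS; rewrite /cloud_pred; case: insubP => // i _ <- Hi.
by rewrite /delay !ext_ord; apply: valid_cloud.
Qed.

Lemma bound_gt : (q %/ p).+1 < L.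
Proof. by rewrite /L; move: (q %/ p) => r; lia. Qed.

Lemma bound_gt1 : 1 < L.
Proof. by rewrite /L; move: (q %/ p) => r; lia. Qed.

Lemma decode_output (cl : nat -> bool) out (g : nat -> nat) :
  (forall i, i < 62 + size inp -> nth 0 out i = g i) ->
  g 0 = 1 -> g 1 = 0 ->
  g 2 = maxn (server_load (ext psf) L cl 0)
    (cloud_delay (ext pcf) (ext cin) (ext cout) L cl 0) ->
  (forall i, i < L -> g (2 * i + 3) = cl i :> nat /\ g (2 * i + 4) =
     if cl i then ext cin i + ext pcf i else server_load (ext psf) L cl i) ->
  exists S, [/\ decode n out = Some S, valid I S,
    makespan I S = g 2 & cost I S = sum_if cl (ext pcf) L].
Proof.
move=> Hout g0 g1 g2 gi; have Hsz := size_enc psf pcf cin cout x p q.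
rewrite -Hout; last by [].
apply: decode_ok; rewrite ?Hout //; first by rewrite /L -addnA leq_addr.
move=> i Hi; rewrite !Hout ?Hsz; [|lia|lia].
by apply: gi; rewrite /L -addnA ltn_addr.
Qed.

Lemma cost_main_ok out :
  (forall i, i < 62 + size inp -> nth 0 out i = sem cost_main s 10 i) ->
  (exists S, valid I S /\ makespan I S <= x) ->
  exists S, decode n out = Some S /\ valid I S /\ makespan I S <= x /\
    forall S', valid I S' -> makespan I S' <= x -> cost I S * q <= (q + p) * cost I S'.
Proof.
move=> Hout [S0 [HS0 Hd0]].
(* The server is the second side, hence the negation; [delay i - x] vanishes for every job on the
   cloud. *)
have feas S : valid I S -> makespan I S <= x ->
    feasible (ext psf) (fun i => delay i - x) x L (negb \o cloud_pred S).
  move=> HS Hd; split; last exact: leq_trans (sum_if_server HS) Hd.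
  move=> i _; rewrite /= negbK => /(cloud_pred_delay HS); lia.
have He s' i : s' 11 0 = i -> (forall j, s' 0 j = s 0 j) ->
    [/\ eval s' (Item 5) = ext pcf i, eval s' (Item 4) = ext psf i,
      eval s' (Minus (Plus (Plus (Item 6) (Item 5)) (Item 7)) (Arr 0 (Cst 0))) = delay i - x &
      eval s' (Cst 0) = 0].
  move=> E F; have [E4 E5 E6 E7] := eval_items E F.
  by split; rewrite // -E6 -[in RHS]E7.
have Hcl s' (b : bool) : s' 15 0 = b :> nat ->
    (eval s' (Minus (Cst 1) (Var 15)) == 0) = ~~ ~~ b.
  by move=> E; rewrite /= E; case: b {E}.
have [y [[Hh Hu] Hopt [O0 O1 O2 Oi]]] := main_ok (cl := negb) He Hcl start_item
  (erefl (s 1 0)) bound_gt bound_gt1 (ex_intro _ _ (feas _ HS0 Hd0)).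
have [S [HS HV Hms Hc]] := decode_output Hout O0 O1 O2 Oi.
exists S; split=> //; split=> //; split.
  rewrite Hms O2 geq_max; apply/andP; split.
    rewrite server_load0 (@eq_sum_if _ y) // => i _ /=; exact: negbK.
  rewrite /cloud_delay; apply/bigmax_leqP_seq => i; rewrite mem_index_iota => Hi _ /=.
  by case: ifP => // Hy; have := Hh i Hi Hy; rewrite /delay; lia.
move=> S' HS' Hd'; have Hopt' := Hopt _ (feas _ HS' Hd').
apply: approx_ratio => //; rewrite Hc.
apply: (@leq_trans ((q %/ p).+1 * objective (ext pcf) (fun=> 0) L y)).
  by rewrite leq_mul2l leq_maxl orbT.
apply: leq_trans Hopt' _; rewrite leq_mul2l; apply/orP; right.
(* As all delays are 0 here, the objective is just the first-side load, which is the cost. *)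
rewrite /objective geq_max; apply/andP; split.
  rewrite -sum_if_cloud // (@eq_sum_if _ (cloud_pred S')) // => i _ /=; exact: negbK.
by apply/bigmax_leqP => i _; rewrite if_same.
Qed.

Lemma makespan_main_ok out :
  (forall i, i < 62 + size inp -> nth 0 out i = sem makespan_main s 10 i) ->
  (exists S, valid I S /\ cost I S <= x) ->
  exists S, decode n out = Some S /\ valid I S /\ cost I S <= x /\
    forall S', valid I S' -> cost I S' <= x ->
      makespan I S * q <= (q + p) * makespan I S'.
Proof.
move=> Hout [S0 [HS0 Hd0]].
have feas S : valid I S -> cost I S <= x ->
    feasible (ext pcf) (fun=> 0) x L (cloud_pred S).
  by move=> HS Hd; split=> //; rewrite sum_if_cloud.
have He s' i : s' 11 0 = i -> (forall j, s' 0 j = s 0 j) ->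
    [/\ eval s' (Item 4) = ext psf i, eval s' (Item 5) = ext pcf i,
      eval s' (Cst 0) = 0 &
      eval s' (Plus (Plus (Item 6) (Item 5)) (Item 7)) = delay i].
  by move=> E F; have [E4 E5 E6 _] := eval_items E F.
have Hcl s' (b : bool) : s' 15 0 = b :> nat -> (eval s' (Var 15) == 0) = ~~ id b.
  by move=> E; rewrite /= E; case: b {E}.
have [y [[Hh Hu] Hopt [O0 O1 O2 Oi]]] := main_ok (cl := id) He Hcl start_item
  (erefl (s 1 0)) bound_gt bound_gt1 (ex_intro _ _ (feas _ HS0 Hd0)).
have [S [HS HV Hms Hc]] := decode_output Hout O0 O1 O2 Oi.
exists S; split=> //; split=> //; split; first by rewrite Hc.
move=> S' HS' Hd'; have Hopt' := Hopt _ (feas _ HS' Hd').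
apply: approx_ratio => //.
(* The emitted schedule has no idle server time before its last server job and starts cloud jobs as
   early as possible, so it attains the objective exactly. *)
have -> : makespan I S = objective (ext psf) delay L y.
  by rewrite Hms O2 server_load0 /cloud_delay big_mkord.
apply: leq_trans Hopt' _; rewrite leq_mul2l; apply/orP; right.
rewrite /objective geq_max sum_if_server //=.
by apply/bigmax_leqP => i _; case: ifP => // /cloud_pred_delay; apply.
Qed.

End Final.

Theorem theorem3 : FPTAS_cost /\ FPTAS_makespan.
Proof.
split.
- have [a [k H]] := @program_ok cost_main isT isT isT.
  exists (program cost_main), a, k => n psf pcf cin cout d p q p0 q0 I inp fin.
  have [Hh Ho] := H inp (size_enc psf pcf cin cout d p q) p0; split=> // Hex.
  exact: (@cost_main_ok n psf pcf cin cout d p q p0 _ Ho).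
- have [a [k H]] := @program_ok makespan_main isT isT isT.
  exists (program makespan_main), a, k => n psf pcf cin cout b p q p0 q0 I inp fin.
  have [Hh Ho] := H inp (size_enc psf pcf cin cout b p q) p0; split=> // Hex.
  exact: (@makespan_main_ok n psf pcf cin cout b p q p0 _ Ho).
Qed.
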